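(* Let $\epsilon>0$ be arbitrary, let $g^{-1}$ denote the inverse function of $g$, let $h_1(x)=-\frac{2}{\pi}\log\left(1-e^{-\frac{\pi}{2}x}\right)$ for $x>0$ and $h_2(x)=-\frac{2}{\pi}\log\left(e^{-\frac{\pi}{2}x}-1\right)$ for $x\in\left[-\frac2\pi\log 2,0\right)$, and let $$f_{\overline p}(x):=\left(h_1^{-1}-h_2^{-1}\right)^{-1}(x)=\frac{2}{\pi}\log\left(\frac{1+e^{-\frac{\pi}{2}x}}{1-e^{-\frac{\pi}{2}x}}\right)\qquad (x>0).$$ Then $$\lim_{n\to\infty}\frac{1}{\overline p(n)}\cdot\#\left\{\lambda\in\overline{\mathscr P}(n):\widetilde{\varphi}(\lambda)\subset N_\epsilon(f_{\overline p})\right\}=1,$$ where $\overline{\mathscr P}(n)$ is the set of overpartitions of size $n$ and $\overline p(n)=\#\overline{\mathscr P}(n)$.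
   Context: An overpartition of size $n$ is a partition of $n$ in which the last occurrence of each part size may (or may not) be marked (overlined); e.g. the overpartitions of size $3$ are $(\overline3),(3),(\overline2,\overline1),(\overline2,1),(2,\overline1),(2,1),(1,1,\overline1),(1,1,1)$. The diagram of an overpartition with parts $\lambda_1\ge\lambda_2\ge\dots\ge\lambda_s$ is drawn in the first quadrant as weakly decreasing adjacent columns of unit squares, without distinguishing marked parts: the $j$-th column is $[j-1,j]\times[0,\lambda_j]$. The shape $\varphi(\lambda)$ is the upper border of the diagram: the polygonal path of horizontal and vertical segments following the tops of the columns (with the vertical segments joining consecutive tops) and descending to the $x$-axis at the right end. The renormalized shape $\widetilde{\varphi}(\lambda)$ is obtained from $\varphi(\lambda)$ by rescaling both axes by $1/\sqrt n$, where $n$ is the size of $\lambda$. For a real function $f$ defined on a subset of $\mathbb{R}$, $N_\epsilon(f)$ is the set of points in the plane whose horizontal distance from the curve $y=f(x)$ is at most $\epsilon$ (i.e. points $(x_0,y_0)$ for which there is $x$ in the domain of $f$ with $f(x)=y_0$ and $|x-x_0|\le\epsilon$), together with the $\epsilon$-neighborhoods of the $x$-axis and of the $y$-axis (points at distance at most $\epsilon$ from one of the axes). *)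

(* Defs.v *)
From HB Require Import structures.
From mathcomp Require Import all_boot all_order all_algebra finmap.
From mathcomp Require Import all_classical all_reals all_analysis.

Set Implicit Arguments.
Unset Strict Implicit.
Unset Printing Implicit Defensive.

Import Order.TTheory GRing.Theory Num.Theory.
Import numFieldNormedType.Exports.

Local Open Scope classical_set_scope.
Local Open Scope ring_scope.

(* An overpartition is listed part by part in weakly decreasing order, as pairs
   (size of the part, is the part marked?). *)
Definition parts (s : seq (nat * bool)) : seq nat := [seq p.1 | p <- s].

(* The [pairwise] condition says that a marked part differs in size from every
   part listed after it: only the last occurrence of a size can be marked. *)
Definition is_overpartition (n : nat) (s : seq (nat * bool)) : bool :=
  [&& sorted geq (parts s), all (ltn 0%N) (parts s),
      pairwise (fun p q : nat * bool => p.2 ==> (q.1 != p.1)) s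
    & sumn (parts s) == n].

Definition overpartitions (n : nat) : set (seq (nat * bool)) :=
  [set s | is_overpartition n s].

Lemma finite_overpartitions (n : nat) : finite_set (overpartitions n).
Proof.
pose F (t : n.-bseq ('I_n.+1 * bool)) : seq (nat * bool) :=
  [seq (nat_of_ord p.1, p.2) | p <- t].
apply: (@sub_finite_set _ _ (F @` setT)); last exact/finite_image/finite_finset.
move=> s /and4P[_ s_gt0 _ /eqP sn].
have size_s : (size s <= n)%N.
  rewrite -sn; elim: s s_gt0 {sn} => //= p s IHs /andP[p0 /IHs le_s].
  by rewrite -add1n leq_add.
have part_le p : p \in s -> (p.1 <= n)%N.
  move=> ps; rewrite -sn; elim: s ps {s_gt0 sn size_s} => //= q s IHs.
  rewrite inE => /predU1P[-> | /IHs le_p]; first exact: leq_addr.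
  exact: leq_trans le_p (leq_addl _ _).
have size_t : (size [seq (inord p.1 : 'I_n.+1, p.2) | p <- s] <= n)%N.
  by rewrite size_map.
exists (Bseq size_t) => //; rewrite /F /= -map_comp -[RHS]map_id.
by apply/eq_in_map => -[k b] /part_le /= le_k; rewrite inordK.
Qed.

Definition card_of (T : choiceType) (A : set T) : nat := #|` fset_set A|.

Section Shape.
Variable R : realType.

(* Columns are indexed from 0: column [i] is [i, i+1] x [0, l`_i].  Since [nth]
   returns 0 past the end, the vertical segment of the last column descends to
   the x-axis. *)
Definition shape (s : seq (nat * bool)) : set (R * R) :=
  [set p | exists2 i : nat, (i < size s)%N &
     (i%:R <= p.1 <= i.+1%:R /\ p.2 = (nth 0%N (parts s) i)%:R) \/
     (p.1 = i.+1%:R /\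
      (nth 0%N (parts s) i.+1)%:R <= p.2 <= (nth 0%N (parts s) i)%:R)].

Definition renorm_shape (s : seq (nat * bool)) : set (R * R) :=
  let c := Num.sqrt (sumn (parts s))%:R in
  [set (p.1 / c, p.2 / c) | p in shape s].

(* A real function defined on a subset of the line; the values of [pval]
   outside [pdom] are irrelevant. *)
Record pfun := PFun { pdom : set R; pval : R -> R }.

Definition pinj (f : pfun) : Prop := {in pdom f &, injective (pval f)}.

(* The inverse function, defined on the image of [f]; meaningful under
   [pinj f]. *)
Definition pfun_inv (f : pfun) : pfun :=
  PFun (pval f @` pdom f) ('pinv_(fun=> 0) (pdom f) (pval f)).

Definition pfun_sub (f g : pfun) : pfun :=
  PFun (pdom f `&` pdom g) (fun x => pval f x - pval g x).

Definition h1 : pfun :=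
  PFun [set x | 0 < x]
       (fun x => - (2 / pi) * ln (1 - expR (- (pi / 2) * x))).

Definition h2 : pfun :=
  PFun [set x | - (2 / pi) * ln 2 <= x < 0]
       (fun x => - (2 / pi) * ln (expR (- (pi / 2) * x) - 1)).

Definition f_overp : pfun :=
  pfun_inv (pfun_sub (pfun_inv h1) (pfun_inv h2)).

Definition N_eps (eps : R) (f : pfun) : set (R * R) :=
  [set p | exists x, [/\ pdom f x, pval f x = p.2 & `|x - p.1| <= eps]]
  `|` [set p | `|p.2| <= eps] `|` [set p | `|p.1| <= eps].

End Shape.

Arguments shape R s : clear implicits.
Arguments renorm_shape R s : clear implicits.

(* Main.v *)
Require Import Defs.
From HB Require Import structures.
From mathcomp Require Import all_boot all_order all_algebra finmap.
From mathcomp Require Import all_classical all_reals all_analysis.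
From mathcomp Require Import zify ring lra.
Import Order.TTheory GRing.Theory Num.Theory.
Import numFieldNormedType.Exports.
Local Open Scope classical_set_scope.
Local Open Scope ring_scope.

(** Write [Phi x = ln ((1 + expR (- x)) / (1 - expR (- x)))] and let [pbar n] be
the number of overpartitions of [n]. The generating function of [pbar] is the
product of the factors [(1 + q ^ j) / (1 - q ^ j)] over the part sizes [j], so
that for [q = expR (- t)] its logarithm is the sum of the [Phi (t * j)]. The
proof is a large deviation argument: shapes outside the neighbourhood of the
curve are rarer than overpartitions in general by a factor that is exponentially
small in [sqrt n].

Growth rate. Expanding [Phi] in powers of [expR (- x)] compares the sum of the
[Phi (t * j)] with [2 / t] times the sum of [1 / m ^ 2] over the odd [m], which
is [pi ^ 2 / (4 * t)]; this is an upper bound ([sum_Phi_le]) and the right order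
of magnitude as [t] tends to 0 ([sum_Phi_ge]). Hence [pbar n] is at most
[expR (t * n + pi ^ 2 / (4 * t))], and the best choice [t = pi / (2 * sqrt n)]
gives [expR (pi * sqrt n)]. Conversely, most of the generating function comes
from sizes near the expected one, and [pbar] is nondecreasing, so that [pbar n]
is at least [expR ((pi - e) * sqrt n)] for large [n] ([pbar_ge]).

Deviations. A shape is determined by the numbers of parts that are at least [k],
for all [k]. Weighting each such part by [expR (+- t * a)], where [a] is a
natural number, turns [Phi (t * j)] into [Phi (t * (j -+ a))] for [j >= k], and
the sum telescopes: it changes by about [a * Phi (t * k)], without any
derivative or integral. Chernoff's bound then shows that at a height
[k = z * sqrt n] the number of parts differs from [sqrt n * limit_shape z] by
more than [d * sqrt n] for at most [2 * expR ((pi - kappa) * sqrt n)]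
overpartitions ([count_deviates]), where
[limit_shape z = 2 / pi * Phi (pi / 2 * z)]. By [pbar_ge] this is a negligible
proportion.

From finitely many heights to the shape. The number of parts that are at least
[k] decreases with [k], so control at finitely many heights gives control at all
the heights that are not close to an axis ([renorm_shape_sub]). The heights are
those where the curve meets equally spaced abscissas; they are explicit since
[Phi], and so [limit_shape], is an involution ([PhiK]). The same fact identifies
[f_overp] with [limit_shape] ([f_overpP]). *)

Set Implicit Arguments.
Unset Strict Implicit.
Unset Printing Implicit Defensive.

(** * The sum of the inverse squares of the odd numbers *)

Section Basel.
Context {R : realType}.
Implicit Types x : R.

Lemma sin_le_id x : 0 <= x -> sin x <= x.
Proof.
move=> x0.
have [c _] := @MVT_segment R sin cos 0 x x0 (fun y _ => is_derive_sin y)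
  (continuous_subspaceT (@continuous_sin R)).
rewrite sin0 !subr0 => ->; rewrite ler_piMl //; exact: cos_le1.
Qed.

Lemma id_le_tan x : 0 <= x < pi / 2 -> x * cos x <= sin x.
Proof.
move=> /andP[x0 xpi].
have pos y : 0 <= y <= x -> 0 <= sin y.
  by move=> /andP[y0 yx]; apply: sin_ge0_pi; have := pi_gt0 R; lra.
have D y : y \in `]0, x[ -> is_derive y 1 (fun y => sin y - y * cos y) (y * sin y).
  move=> _; apply: is_derive_eq.
  by rewrite /GRing.scale /=; ring.
have [|c cx] := @MVT_segment R (fun y => sin y - y * cos y) (fun y => y * sin y) 0 x x0 D.
  apply: continuous_subspaceT => y; apply: cvgB; first exact: continuous_sin.
  by apply: cvgM; [exact: cvg_id | exact: continuous_cos].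
rewrite sin0 mul0r !subr0 => E; rewrite -subr_ge0 E.
move: cx; rewrite in_itv /= => cx.
by rewrite !mulr_ge0 // ?pos //; case/andP: cx.
Qed.

(** Iterated from [x = pi / 2], where the left-hand side is 1, this identity
evaluates sums of [1 / sin ^ 2] over the odd multiples of [pi / 2 ^ n.+1]
without any trigonometric polynomial. *)
Lemma inv_sin2_halve x : sin x != 0 ->
  (sin x ^+ 2)^-1 =
  ((sin (x / 2) ^+ 2)^-1 + (sin ((x + pi) / 2) ^+ 2)^-1) / 4.
Proof.
move=> sx.
have E : sin x = sin (x / 2) * cos (x / 2) *+ 2.
  by rewrite [_ * cos _]mulrC -sin_mulr2n -[_ *+ 2]mulr_natr divfK.
have -> : (x + pi) / 2 = x / 2 + pi / 2 by field.
rewrite sinDpihalf E.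
move: sx; rewrite E mulrn_eq0 /= mulf_eq0 negb_or => /andP[s0 c0].
have := cos2Dsin2 (x / 2); move: s0 c0.
move: (sin _) (cos _) => s c s0 c0 sc.
have -> : (s * c *+ 2) ^+ 2 = 4 * (s ^+ 2 * c ^+ 2) by ring.
have -> : (s ^+ 2)^-1 + (c ^+ 2)^-1 = (c ^+ 2 + s ^+ 2) / (s ^+ 2 * c ^+ 2).
  by field; rewrite s0 c0.
by rewrite sc; field; rewrite s0 c0.
Qed.

Lemma big_ord_double (F : nat -> R) (m : nat) :
  \sum_(k < m.*2) F k = \sum_(k < m) F k.*2 + \sum_(k < m) F k.*2.+1.
Proof.
elim: m => [|m IH]; first by rewrite !big_ord0 addr0.
by rewrite doubleS !big_ord_recr /= IH; ring.
Qed.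

Lemma sum_inv_sin2 (n : nat) x : sin x != 0 ->
  \sum_(k < 2 ^ n) (sin ((x + k%:R * pi) / (2 ^ n)%:R) ^+ 2)^-1 =
  4 ^+ n * (sin x ^+ 2)^-1.
Proof.
elim: n x => [|n IH] x sx.
  by rewrite big_ord1 mul0r addr0 divr1 expr0 mul1r.
have s1 : sin (x / 2) != 0 /\ sin ((x + pi) / 2) != 0.
  have -> : (x + pi) / 2 = x / 2 + pi / 2 by field.
  move: sx; rewrite sinDpihalf {1}(_ : x = x / 2 *+ 2); last first.
    by rewrite -[_ *+ 2]mulr_natr divfK.
  by rewrite sin_mulr2n mulrn_eq0 /= mulf_eq0 negb_or => /andP[].
case: s1 => s1 s2.
rewrite expnS mul2n (big_ord_double (fun k : nat =>
  (sin ((x + k%:R * pi) / (2 ^ n).*2%:R) ^+ 2)^-1)) (inv_sin2_halve sx) [4 ^+ n.+1]exprSr.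
rewrite -mulrA [4 * (_ / 4)]mulrC divfK // mulrDr -!IH //.
have n0 : (2 ^ n)%:R != 0 :> R by rewrite pnatr_eq0 expn_eq0.
congr +%R; apply: eq_bigr => k _; congr (sin _ ^+ 2)^-1.
  by rewrite -!mul2n !natrM; field.
by rewrite -!mul2n -addn1 natrD !natrM; field.
Qed.

Definition odd_basel (L : nat) : R := \sum_(l < L) ((l.*2.+1)%:R ^+ 2)^-1.

(** The angles [y] and [pi - y] contribute equally, so that half of the sum
remains, with angles below [pi / 2]. *)
Lemma sum_inv_sin2_half (n : nat) :
  \sum_(k < 2 ^ n) (sin ((k.*2.+1)%:R * pi / (4 * (2 ^ n)%:R) : R) ^+ 2)^-1 =
  2 * 4 ^+ n.
Proof.
have n0 : (2 ^ n)%:R != 0 :> R by rewrite pnatr_eq0 expn_eq0.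
have := @sum_inv_sin2 n.+1 (pi / 2); rewrite sin_pihalf oner_eq0 => /(_ isT).
rewrite expr1n invr1 mulr1 expnS mul2n -addnn big_split_ord /=.
rewrite [X in _ + X](reindex_inj rev_ord_inj) /=.
set S := (X in X + _ = _ -> _); set T := (X in _ + X = _ -> _).
have sinpiB y : sin (pi - y) = sin y :> R by rewrite addrC sinDpi sinN opprK.
have -> : T = S.
  apply: eq_bigr => k _.
  rewrite -sinpiB; congr (sin _ ^+ 2)^-1.
  rewrite !natrD natrB; last by [].
  rewrite -[k.+1]addn1 !natrD; move: n0; move: (2 ^ n)%:R => N n0.
  by field; rewrite -mulr2n mulrn_eq0.
have -> : S = \sum_(k < 2 ^ n) (sin ((k.*2.+1)%:R * pi / (4 * (2 ^ n)%:R) : R) ^+ 2)^-1.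
  apply: eq_bigr => k _; congr (sin _ ^+ 2)^-1.
  rewrite -[k.*2.+1]addn1 -mul2n [(_ * k + 1)%:R]natrD [(_ * k)%:R]natrM.
  rewrite [(_ + _)%:R]natrD; move: n0; move: (2 ^ n)%:R => N n0.
  by field; rewrite -mulr2n mulrn_eq0 n0.
by rewrite exprS => E; apply: (@mulfI _ 2) => //; rewrite mulr2n mulrDl mul1r E; ring.
Qed.

(** For [0 < y < pi / 2] the inequalities [sin y <= y <= tan y] squeeze
[1 / sin y ^ 2] between [1 / y ^ 2] and [1 / y ^ 2 + 1]; the [2 ^ n] errors of
at most 1 are negligible against the total [2 * 4 ^ n]. *)
Lemma odd_basel_bounds (n : nat) :
  pi ^+ 2 / 8 - (2 ^ n)%:R^-1 <= odd_basel (2 ^ n) <= pi ^+ 2 / 8.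
Proof.
have n0 : 0 < (2 ^ n)%:R :> R by rewrite ltr0n expn_gt0.
have p0 := pi_gt0 R.
pose x (k : nat) : R := (k.*2.+1)%:R * pi / (4 * (2 ^ n)%:R).
have E4 : 4 ^+ n = (2 ^ n)%:R ^+ 2 :> R.
  by rewrite natrX -exprM mulnC exprM; congr (_ ^+ n); ring.
have xI (k : 'I_(2 ^ n)) : 0 < x k < pi / 2.
  have x0 : 0 < x k by rewrite divr_gt0 // mulr_gt0 // ltr0n.
  rewrite x0 /= /x ltr_pdivrMr ?mulr_gt0 //.
  have -> : pi / 2 * (4 * (2 ^ n)%:R) = 2 * (2 ^ n)%:R * pi :> R by field.
  rewrite ltr_pM2r // -natrM ltr_nat mul2n.
  by rewrite -doubleS leq_double ltn_ord.
have xE (j : nat) : (x j ^+ 2)^-1 =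
    16 * 4 ^+ n / pi ^+ 2 * ((j.*2.+1)%:R ^+ 2)^-1.
  have j0 : (j.*2.+1)%:R != 0 :> R by rewrite pnatr_eq0.
  rewrite /x E4; move: (j.*2.+1)%:R j0 (pi : R) (lt0r_neq0 p0) => J J0 P P0.
  by field; rewrite J0 P0 lt0r_neq0.
have xS (i : 'I_(2 ^ n)) : (x i ^+ 2)^-1 <= (sin (x i) ^+ 2)^-1 <= (x i ^+ 2)^-1 + 1.
  have /andP[x0 xpi] := xI i.
  have s0 : 0 < sin (x i) by apply: sin_gt0_pihalf; rewrite x0.
  have sx := sin_le_id (ltW x0).
  have xc : x i * cos (x i) <= sin (x i) by apply: id_le_tan; rewrite ltW.
  have c0 : 0 <= cos (x i) by apply/ltW/cos_gt0_pihalf; rewrite xpi andbT; lra.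
  have s2 : sin (x i) ^+ 2 <= x i ^+ 2 by rewrite ler_sqr ?nnegrE ?(ltW s0) ?(ltW x0).
  rewrite lef_pV2 ?posrE ?exprn_gt0 // s2 /=.
  have cs := cos2Dsin2 (x i).
  have xc2 : (x i * cos (x i)) ^+ 2 <= sin (x i) ^+ 2.
    by rewrite ler_sqr ?nnegrE ?(ltW s0) //; apply: mulr_ge0 => //; exact: ltW.
  rewrite exprMn in xc2.
  move: (sin (x i) ^+ 2) (cos (x i) ^+ 2) (x i ^+ 2) cs xc2
    (exprn_gt0 2 s0) (exprn_gt0 2 x0) => s c y cs yc s_gt0 y_gt0.
  have -> : y^-1 + 1 = (y + 1) / y by field; exact: lt0r_neq0.
  by rewrite ler_pdivlMr // mulrC ler_pdivrMr //; nra.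
have S1 := sum_inv_sin2_half n.
have SX : \sum_(k < 2 ^ n) (x k ^+ 2)^-1 = 16 * 4 ^+ n / pi ^+ 2 * odd_basel (2 ^ n).
  by rewrite /odd_basel mulr_sumr; apply: eq_bigr => k _.
have up : 16 * 4 ^+ n / pi ^+ 2 * odd_basel (2 ^ n) <= 2 * 4 ^+ n.
  by rewrite -SX -S1; apply: ler_sum => k _; have /andP[] := xS k.
have lo : 2 * 4 ^+ n <= 16 * 4 ^+ n / pi ^+ 2 * odd_basel (2 ^ n) + (2 ^ n)%:R.
  rewrite -SX -S1 -[X in _ <= _ + X%:R]card_ord -sumr_const -big_split /=.
  by apply: ler_sum => k _; have /andP[] := xS k.
move: up lo; rewrite E4; move: n0; move: (2 ^ n)%:R (odd_basel _) => N b n0.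
move=> up lo.
have N2 : 0 < N ^+ 2 by rewrite exprn_gt0.
have P2 : 0 < (pi : R) ^+ 2 by rewrite exprn_gt0.
have P16 : pi ^+ 2 <= 16 :> R.
  have := @pihalf_lt2 R; move: p0; move: (pi : R) => p p0 p4; nra.
have -> : b = pi ^+ 2 / 16 / N ^+ 2 * (16 * N ^+ 2 / pi ^+ 2 * b).
  by move: (pi : R) p0 => p p0; field; rewrite !lt0r_neq0.
apply/andP; split.
  have -> : pi ^+ 2 / 8 - N^-1 = pi ^+ 2 / 16 / N ^+ 2 * (2 * N ^+ 2 - 16 * N / pi ^+ 2).
    by move: (pi : R) p0 => p p0; field; rewrite !lt0r_neq0.
  rewrite ler_pM2l ?divr_gt0 // lerBlDr (le_trans lo) // lerD2l.
  by rewrite ler_pdivlMr // mulrC ler_pM2r.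
have -> : pi ^+ 2 / 8 = pi ^+ 2 / 16 / N ^+ 2 * (2 * N ^+ 2) :> R.
  by move: (pi : R) p0 => p p0; field; rewrite !lt0r_neq0.
by rewrite ler_pM2l ?divr_gt0.
Qed.

Lemma odd_basel_le (L : nat) : odd_basel L <= pi ^+ 2 / 8.
Proof.
have /andP[_] := odd_basel_bounds L; apply: le_trans.
apply: (@homo_leq _ odd_basel (fun x y => x <= y)) => //; [exact: le_trans| |].
  by move=> n; rewrite /odd_basel big_ord_recr /= lerDl invr_ge0 exprn_ge0.
by rewrite ltnW // ltn_expl.
Qed.

Lemma odd_basel_ge (e : R) : 0 < e -> exists L, pi ^+ 2 / 8 - e <= odd_basel L.
Proof.
move=> e0; exists (2 ^ Num.bound (e^-1))%N.
have /andP[+ _] := odd_basel_bounds (Num.bound (e^-1)); apply: le_trans.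
rewrite lerD2l lerN2 -[leRHS]invrK lef_pV2 ?posrE ?invr_gt0 ?ltr0n ?expn_gt0 //.
rewrite (le_trans (ltW (archi_boundP _))) ?invr_ge0 ?(ltW e0) //.
by rewrite ler_nat ltnW // ltn_expl.
Qed.

End Basel.

(** * Logarithms of Euler factors *)

Section Phi.
Context {R : realType}.
Implicit Types x y t : R.

(** The logarithm of the Euler factor [(1 + q) / (1 - q)] of one part size, at
[q = expR (- x)]. *)
Definition Phi x : R := ln ((1 + expR (- x)) / (1 - expR (- x))).

Lemma expRN_lt1 x : 0 < x -> expR (- x) < 1.
Proof. by move=> x0; rewrite expR_lt1 oppr_lt0. Qed.

Lemma expR_Phi x : 0 < x -> expR (Phi x) = (1 + expR (- x)) / (1 - expR (- x)).
Proof.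
move=> x0; rewrite /Phi lnK // posrE; apply: divr_gt0.
  by rewrite addr_gt0 ?expR_gt0.
by rewrite subr_gt0 expRN_lt1.
Qed.

Lemma Phi_gt0 x : 0 < x -> 0 < Phi x.
Proof.
move=> x0; rewrite -expR_gt1 expR_Phi // ltr_pdivlMr ?subr_gt0 ?expRN_lt1 //.
by have := expR_gt0 (- x); lra.
Qed.

Lemma Phi_decr x y : 0 < x -> x < y -> Phi y < Phi x.
Proof.
move=> x0 xy; have y0 := lt_trans x0 xy.
rewrite -ltr_expR !expR_Phi //.
rewrite ltr_pdivrMr ?subr_gt0 ?expRN_lt1 // mulrAC.
rewrite ltr_pdivlMr ?subr_gt0 ?expRN_lt1 //.
have : expR (- y) < expR (- x) by rewrite ltr_expR ltrN2.
by nra.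
Qed.

Lemma Phi_le x y : 0 < x -> x <= y -> Phi y <= Phi x.
Proof.
by move=> x0; rewrite le_eqVlt => /predU1P[->//|xy]; exact/ltW/Phi_decr.
Qed.

(** The graph [y = Phi x] is the curve [e^-x + e^-y + e^-(x+y) = 1], which is
symmetric in [x] and [y]. *)
Lemma PhiK x : 0 < x -> Phi (Phi x) = x.
Proof.
move=> x0; apply: expR_inj; rewrite (expR_Phi (Phi_gt0 x0)) expRN expR_Phi //.
have e1 := expRN_lt1 x0; have e0 := expR_gt0 (- x).
have -> : expR x = (expR (- x))^-1 by rewrite expRN invrK.
move: (expR (- x)) e0 e1 => e e0 e1.
have n1 : 1 - e != 0 by rewrite subr_eq0 gt_eqF.
have n2 : 1 + e != 0 by rewrite lt0r_neq0 // addr_gt0.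
field; rewrite lt0r_neq0 //= n2 n1 /=.
by rewrite (_ : _ - _ = 2 * e); [rewrite mulf_neq0 // lt0r_neq0|ring].
Qed.

(** Continuity of an involution comes from its monotonicity: the increments
that achieve a given precision are read off from [Phi] itself. *)
Lemma Phi_cont x (e : R) : 0 < x -> 0 < e ->
  exists2 d : R, 0 < d & forall y, 0 < y ->
   (x - d <= y -> Phi y <= Phi x + e) /\ (y <= x + d -> Phi x - e <= Phi y).
Proof.
move=> x0 e0; have p0 := Phi_gt0 x0.
have pe : 0 < Phi x + e by rewrite addr_gt0.
have d1 : Phi (Phi x + e) < x by rewrite -{2}(PhiK x0) Phi_decr // ltrDl.
have lo y : 0 < y -> Phi (Phi x + e) <= y -> Phi y <= Phi x + e.
  by move=> y0 ly; rewrite -(PhiK pe) Phi_le // Phi_gt0.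
have [pe'|pe'] := leP (Phi x - e) 0.
  exists (x - Phi (Phi x + e)); first by rewrite subr_gt0.
  move=> y y0; split; first by rewrite subKr; exact: lo.
  by move=> _; rewrite (le_trans pe') // ltW // Phi_gt0.
have d2 : x < Phi (Phi x - e).
  by rewrite -{1}(PhiK x0) Phi_decr // ltrBlDr ltrDl.
exists (Num.min (x - Phi (Phi x + e)) (Phi (Phi x - e) - x)).
  by rewrite lt_min !subr_gt0 d1.
move=> y y0; split => [h|h].
  apply: lo => //; apply: le_trans h.
  by rewrite -[leLHS](subKr x) lerD2l lerN2 ge_min lexx.
rewrite -(PhiK pe') Phi_le //; apply: le_trans h _.
by rewrite addrC -lerBrDr ge_min lexx orbT.
Qed.

(** Partial sums of the expansion of [ln ((1 + q) / (1 - q))] as twice the sum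
of [q ^ m / m] over the odd [m]. *)
Definition Phi_trunc (L : nat) x : R :=
  2 * \sum_(l < L) expR (- x) ^+ l.*2.+1 / (l.*2.+1)%:R.

Lemma is_derive_ln_ratio_rem (L : nat) y : -1 < y < 1 ->
  is_derive y 1 (fun y : R => ln (1 + y) - ln (1 - y) -
      2 * \sum_(l < L) y ^+ l.*2.+1 / (l.*2.+1)%:R)
    (2 * y ^+ L.*2 / (1 - y ^+ 2)).
Proof.
move=> /andP[y1 y2].
have p1 : 0 < 1 + y by lra.
have p2 : 0 < 1 - y by lra.
elim: L => [|L IH].
  rewrite (_ : (fun _ => _) = (fun y : R => ln (1 + y) - ln (1 - y))); last first.
    by apply/funext => z; rewrite big_ord0 mulr0 subr0.
  have d1 : is_derive y 1 (fun y : R => ln (1 + y)) ((1 + y)^-1 * 1).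
    apply: is_derive1_comp; first exact: is_derive1_ln.
    by apply: is_derive_eq; rewrite add0r.
  have d2 : is_derive y 1 (fun y : R => ln (1 - y)) ((1 - y)^-1 * (-1)).
    apply: (@is_derive1_comp _ (@ln R) (fun y => 1 - y)); first exact: is_derive1_ln.
    by apply: is_derive_eq; rewrite add0r mul1r.
  apply: is_derive_eq; rewrite expr0.
  by field; rewrite !lt0r_neq0 //; nra.
have c0 : (L.*2.+1)%:R != 0 :> R by rewrite pnatr_eq0.
have d : is_derive y 1 (fun y : R => 2 / (L.*2.+1)%:R * y ^+ L.*2.+1) (2 * y ^+ L.*2).
  have -> : (fun y : R => 2 / (L.*2.+1)%:R * y ^+ L.*2.+1) =
      (2 / (L.*2.+1)%:R : R) \*: (id ^+ L.*2.+1 : R -> R).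
    by apply/funext => z; rewrite /= exprfctE.
  have dX := @is_deriveX _ _ id L.*2.+1 y 1 1 (is_derive_id _ _).
  apply: is_derive_eq; rewrite /GRing.scale /= mulr1.
  by rewrite mulrA divfK.
rewrite (_ : (fun _ => _) = (fun y : R => (ln (1 + y) - ln (1 - y) -
     2 * \sum_(l < L) y ^+ l.*2.+1 / (l.*2.+1)%:R) -
     2 / (L.*2.+1)%:R * y ^+ L.*2.+1)); last first.
  by apply/funext => z; rewrite big_ord_recr /=; ring.
apply: is_derive_eq; rewrite doubleS !exprS.
by field; nra.
Qed.

Lemma Phi_truncP (L : nat) x : 0 < x ->
  0 <= Phi x - Phi_trunc L x <= 2 * expR (- x) ^+ L.*2 / (1 - expR (- x)).
Proof.
move=> x0; rewrite /Phi /Phi_trunc.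
have := expR_gt0 (- x); have := expRN_lt1 x0; move: (expR (- x)) => q q1 q0.
pose F y : R := ln (1 + y) - ln (1 - y) - 2 * \sum_(l < L) y ^+ l.*2.+1 / (l.*2.+1)%:R.
pose dF y : R := 2 * y ^+ L.*2 / (1 - y ^+ 2).
have D y : y \in `[0, q]%R -> is_derive y 1 F (dF y).
  by rewrite in_itv /= => /andP[y0 yq]; apply: is_derive_ln_ratio_rem; lra.
have [c] := @MVT_segment R F dF 0 q (ltW q0)
    (fun y yI => D y (subset_itv_oo_cc yI))
    (derivable_within_continuous (fun y yI => @ex_derive _ _ _ _ _ _ _ (D y yI))).
rewrite in_itv /= => /andP[c0 cq].
rewrite /F addr0 subr0 ln1 subrr [X in 0 - 2 * X]big1; last first.
  by move=> i _; rewrite expr0n mul0r.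
rewrite mulr0 !subr0 -ln_div ?posrE; [|lra|lra] => ->.
rewrite /dF; have c2 : 0 < 1 - c ^+ 2 by nra.
have cn : 0 <= c ^+ L.*2 <= q ^+ L.*2.
  by rewrite exprn_ge0 //= lerXn2r ?nnegrE // ltW.
have /andP[cn0 cnq] := cn.
have q2 : 0 < 1 - q by rewrite subr_gt0.
apply/andP; split.
  by rewrite mulr_ge0 ?(ltW q0) // divr_ge0 ?(ltW c2) // mulr_ge0.
rewrite -mulrA ler_pM ?mulr_ge0 ?invr_ge0 ?(ltW c2) ?(ltW q0) // ?ler_pM2l //.
rewrite mulrC ler_pdivrMr // mulrC ler_pdivlMr //.
by nra.
Qed.

Lemma Phi_trunc_le (L : nat) x : 0 < x -> Phi_trunc L x <= Phi x.
Proof. by move=> x0; have /andP[+ _] := Phi_truncP L x0; rewrite subr_ge0. Qed.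

Lemma sum_expr1 (q : R) (M : nat) : q != 1 ->
  \sum_(1 <= j < M.+1) q ^+ j = q * (1 - q ^+ M) / (1 - q).
Proof.
move=> q1; have n1 : 1 - q != 0 by rewrite subr_eq0 eq_sym.
elim: M => [|M IH]; first by rewrite big_geq // expr0 subrr mulr0 mul0r.
by rewrite big_nat_recr //= IH exprS; field.
Qed.

Lemma sum_Phi_trunc (L M : nat) t :
  \sum_(1 <= j < M.+1) Phi_trunc L (t * j%:R) =
  2 * \sum_(l < L)
     (\sum_(1 <= j < M.+1) expR (- ((l.*2.+1)%:R * t)) ^+ j) / (l.*2.+1)%:R.
Proof.
rewrite -mulr_sumr; congr (_ * _); rewrite exchange_big /=.
apply: eq_bigr => l _; rewrite mulr_suml; apply: eq_bigr => j _.
congr (_ / _); rewrite -!expRM_natl; congr expR; ring.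
Qed.

Lemma geom_le (u : R) (M : nat) : 0 < u ->
  \sum_(1 <= j < M.+1) expR (- u) ^+ j <= u^-1.
Proof.
move=> u0; have q1 := expRN_lt1 u0; have q0 := expR_gt0 (- u).
rewrite sum_expr1 ?lt_eqF // ler_pdivrMr ?subr_gt0 //.
rewrite -(ler_pM2l u0) [leRHS]mulrA mulfV ?lt0r_neq0 // mul1r.
have e : expR (- u) * (1 + u) <= 1.
  by rewrite expRN mulrC ler_pdivrMr ?expR_gt0 // mul1r expR_ge1Dx.
have qM : 0 <= expR (- u) ^+ M by rewrite exprn_ge0 // ltW.
have : expR (- u) * u * expR (- u) ^+ M >= 0 by rewrite !mulr_ge0 // ltW.
by move: (expR (- u)) (expR (- u) ^+ M) q0 q1 e qM => q r; nra.
Qed.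

Lemma geom_ge (u : R) (M : nat) : 0 < u ->
  (u^-1 - 1) * (1 - expR (- u) ^+ M) <= \sum_(1 <= j < M.+1) expR (- u) ^+ j.
Proof.
move=> u0; have q1 := expRN_lt1 u0; have q0 := expR_gt0 (- u).
rewrite sum_expr1 ?lt_eqF // mulrAC; apply: ler_wpM2r.
  by rewrite subr_ge0 exprn_ile1 // ltW.
rewrite ler_pdivlMr ?subr_gt0 // -(ler_pM2l u0).
have -> : u * ((u^-1 - 1) * (1 - expR (- u))) = (1 - u) * (1 - expR (- u)).
  by field; rewrite lt0r_neq0.
by have := expR_ge1Dx (- u); nra.
Qed.

(** The exact bound [pi^2 / (4 t)] is the integral of [Phi] over the half-line,
divided by [t]; comparing geometric series termwise replaces the integral. *)
Lemma sum_Phi_le (t : R) (M : nat) : 0 < t ->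
  \sum_(1 <= j < M.+1) Phi (t * j%:R) <= pi ^+ 2 / 4 / t.
Proof.
move=> t0.
have q0 := expR_gt0 (- t); have q1 := expRN_lt1 t0.
pose c : R := M%:R * (2 / (1 - expR (- t))).
have H (L : nat) : \sum_(1 <= j < M.+1) Phi (t * j%:R) <=
    pi ^+ 2 / 4 / t + c * (expR (- t) ^+ 2) ^+ L.
  have -> : c * (expR (- t) ^+ 2) ^+ L =
      \sum_(1 <= j < M.+1) 2 * expR (- t) ^+ L.*2 / (1 - expR (- t)).
    rewrite sumr_const_nat subn1 /= -[_ *+ M]mulr_natl /c -exprM mul2n; ring.
  have B : \sum_(1 <= j < M.+1) Phi_trunc L (t * j%:R) <= pi ^+ 2 / 4 / t.
    rewrite sum_Phi_trunc; apply: le_trans (_ : 2 * (t^-1 * odd_basel L) <= _).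
      rewrite ler_pM2l // /odd_basel mulr_sumr; apply: ler_sum => l _.
      have m0 : 0 < (l.*2.+1)%:R :> R by rewrite ltr0n.
      rewrite ler_pdivrMr //; apply: le_trans (geom_le _ (mulr_gt0 m0 t0)) _.
      by rewrite le_eqVlt; apply/orP; left; apply/eqP; field; rewrite !lt0r_neq0.
    have t2 : 0 <= 2 / t by rewrite ltW // divr_gt0.
    have := ler_wpM2l t2 (odd_basel_le L).
    rewrite mulrA => /le_trans; apply.
    rewrite le_eqVlt; apply/orP; left; apply/eqP.
    by move: (pi : R) => p; field; rewrite lt0r_neq0.
  rewrite -lerBlDl; apply: le_trans (_ : \sum_(1 <= j < M.+1)
    (Phi (t * j%:R) - Phi_trunc L (t * j%:R)) <= _).
    by rewrite sumrB lerD2l lerN2.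
  rewrite big_nat [leRHS]big_nat; apply: ler_sum => j /andP[j1 _].
  have tj : t <= t * j%:R by rewrite ler_peMr ?(ltW t0) // ler1n.
  have tj0 := lt_le_trans t0 tj.
  have /andP[_ /le_trans] := Phi_truncP L tj0; apply.
  have qj : expR (- (t * j%:R)) <= expR (- t) by rewrite ler_expR lerN2.
  have qj1 := expRN_lt1 tj0; have qj0 := expR_gt0 (- (t * j%:R)).
  apply: ler_pM.
  - by rewrite mulr_ge0 // exprn_ge0 // ltW.
  - by rewrite invr_ge0 subr_ge0 ltW.
  - by rewrite ler_pM2l // lerXn2r ?nnegrE // ltW.
  - by rewrite lef_pV2 ?posrE ?subr_gt0 // lerD2l lerN2.
have cv : (fun L => pi ^+ 2 / 4 / t + c * (expR (- t) ^+ 2) ^+ L) @ \oo -->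
    pi ^+ 2 / 4 / t.
  rewrite -[X in _ --> X]addr0 -[X in _ + X](mulr0 c).
  apply: cvgD; first exact: cvg_cst.
  apply: cvgMr; apply: cvg_expr.
  by rewrite normrX expr_lt1 // gtr0_norm.
by apply: cvgr_to_ge cv _; apply: nearW => L; exact: H.
Qed.

(** Truncate the expansion of [Phi] at a level [L] where the odd Basel sum is
almost [pi ^ 2 / 8]; the finitely many geometric series are then within a
constant of their leading terms [1 / (m * t)]. *)
Lemma sum_Phi_ge (e : R) : 0 < e -> exists2 t0 : R, 0 < t0 &
  forall t, 0 < t < t0 -> exists M : nat,
    (pi ^+ 2 / 4 - e) / t <= \sum_(1 <= j < M.+1) Phi (t * j%:R).
Proof.
move=> e0; have [L HL] := @odd_basel_ge R (e / 4) (divr_gt0 e0 (ltr0n _ 4)).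
exists (e / (8 * L.+1%:R)); first by rewrite divr_gt0 // mulr_gt0.
move=> t /andP[t0 tL]; exists (Num.bound ((t ^+ 2)^-1)).
set M := Num.bound _.
have tM : expR (- (t * M%:R)) <= t.
  have M1 : (t ^+ 2)^-1 < M%:R by apply: archi_boundP; rewrite invr_ge0 exprn_ge0 // ltW.
  have M2 : t^-1 <= t * M%:R.
    rewrite -(ler_pM2l t0) mulfV ?lt0r_neq0 // mulrA -expr2.
    by rewrite -ler_pdivrMl ?exprn_gt0 // mulr1 ltW.
  rewrite expRN -[leRHS]invrK lef_pV2 ?posrE ?expR_gt0 ?invr_gt0 //.
  by rewrite (le_trans M2) // (le_trans _ (expR_ge1Dx _)) // lerDr.
apply: (@le_trans _ _ (\sum_(1 <= j < M.+1) Phi_trunc L (t * j%:R))); last first.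
  rewrite big_nat [leRHS]big_nat; apply: ler_sum => j /andP[j1 _].
  by rewrite Phi_trunc_le // mulr_gt0 // ltr0n.
rewrite sum_Phi_trunc.
apply: (@le_trans _ _ (2 * (t^-1 * odd_basel L - 2 * L%:R))).
  have tL' : 8 * L%:R * t <= e.
    move: tL; rewrite ltr_pdivlMr ?mulr_gt0 // => tL.
    apply: le_trans (ltW tL); rewrite mulrC ler_pM2l // ler_pM2l //.
    by rewrite ler_nat.
  rewrite ler_pdivrMr //.
  have -> : 2 * (t^-1 * odd_basel L - 2 * L%:R) * t = 2 * odd_basel L - (8 * L%:R * t) / 2.
    by field; rewrite lt0r_neq0.
  move: HL; move: (pi ^+ 2 : R) => p; lra.
rewrite ler_pM2l // /odd_basel mulr_sumr.
have -> : 2 * L%:R = \sum_(l < L) 2 :> R by rewrite sumr_const card_ord mulr_natr.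
rewrite -sumrB; apply: ler_sum => l _.
have m1 : 1 <= (l.*2.+1)%:R :> R by rewrite ler1n.
have := geom_ge M (_ : 0 < (l.*2.+1)%:R * t); rewrite mulr_gt0 // => /(_ isT).
move: (l.*2.+1)%:R m1 => m m1; move: (\sum_(1 <= j < M.+1) _) => G.
have m0 : 0 < m by lra.
have mt0 : 0 < m * t by rewrite mulr_gt0.
have r0 : 0 <= expR (- (m * t)) ^+ M <= m * t.
  rewrite exprn_ge0 ?expR_ge0 //= -expRM_natr.
  apply: (@le_trans _ _ (expR (- (t * M%:R)))).
    rewrite ler_expR mulNr lerN2 ler_wpM2r // ler_peMl // ltW //.
  by rewrite (le_trans tM) // ler_peMl // ltW.
move: (expR _ ^+ M) r0 => r /andP[r0 r1] HG.
have -> : t^-1 * (m ^+ 2)^-1 - 2 = ((m * t)^-1 - 2 * m) / m.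
  by field; rewrite !lt0r_neq0.
rewrite ler_wpM2r ?invr_ge0 ?(ltW m0) //.
apply: le_trans HG.
have : (m * t)^-1 * r <= 1 by rewrite mulrC ler_pdivrMr // mul1r.
by nra.
Qed.

End Phi.

(** * Weighted enumeration of overpartitions *)

Lemma is_overpartition_cons (n k : nat) (b : bool) (s : seq (nat * bool)) :
  is_overpartition n ((k, b) :: s) =
  [&& (0 < k)%N, (k <= n)%N, all (geq k) (parts s),
      b ==> (k \notin parts s) & is_overpartition (n - k) s].
Proof.
rewrite /is_overpartition /= (path_sortedE (rev_trans leq_trans)).
have -> : all (fun q : nat * bool => b ==> (q.1 != k)) s =
          (b ==> (k \notin parts s)).
  case: b => /=; last by elim: s.
  by elim: s => //= p s IH; rewrite inE negb_or IH eq_sym.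
have -> : (k + sumn (parts s) == n)%N = (k <= n)%N && (sumn (parts s) == n - k)%N.
  by apply/idP/idP; lia.
case: (all (geq k) _); case: (0 < k)%N; case: (k <= n)%N; case: (b ==> _);
by rewrite /= ?andbF.
Qed.

Definition ops_set (M n : nat) : set (seq (nat * bool)) :=
  [set s | overpartitions n s /\ all (geq M) (parts s)].

Definition ops (M n : nat) : seq (seq (nat * bool)) := fset_set (ops_set M n).

Lemma uniq_ops (M n : nat) : uniq (ops M n).
Proof. exact: fset_uniq. Qed.

Lemma mem_ops (M n : nat) (s : seq (nat * bool)) :
  (s \in ops M n) = is_overpartition n s && all (geq M) (parts s).
Proof.
rewrite /ops in_fset_set; last first.
  by apply: (sub_finite_set _ (finite_overpartitions n)) => ? [].
by apply/idP/andP => [/set_mem[]|[? ?]]; first by []; apply/mem_set; split.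
Qed.

Lemma part_le_size (n : nat) (s : seq (nat * bool)) :
  is_overpartition n s -> all (geq n) (parts s).
Proof.
case/and4P => _ _ _ /eqP <-; elim: s => //= p s IH.
rewrite leq_addr /=; apply: sub_all IH => k /= /leq_trans; apply.
exact: leq_addl.
Qed.

Lemma ops0 (n : nat) : perm_eq (ops 0 n) (if n == 0%N then [:: [::]] else [::]).
Proof.
apply: uniq_perm; [exact: uniq_ops | by case: eqP | move=> s].
rewrite mem_ops; case: s => [|[k b] s]; rewrite /is_overpartition /=.
  by rewrite eq_sym; case: eqP.
by case: k => [|k]; rewrite ?andbF //; case: eqP.
Qed.

(** The first part of the list is the largest. If it is a marked [M.+1], all the
later parts are smaller than [M.+1], and if it is an unmarked [M.+1], it puts no
condition on them. For generating functions this says that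
[(1 - q ^ M.+1) Z_(M.+1) = (1 + q ^ M.+1) Z_M]. *)
Lemma opsS (M n : nat) :
  perm_eq (ops M.+1 n)
    (ops M n ++ if (M < n)%N then
       [seq (M.+1, true) :: s | s <- ops M (n - M.+1)] ++
       [seq (M.+1, false) :: s | s <- ops M.+1 (n - M.+1)] else [::]).
Proof.
have cinj (b : bool) : injective (cons (M.+1, b)) by move=> ? ? [].
have hd s (b : bool) n' : (M.+1, b) :: s \notin ops M n'.
  by rewrite mem_ops /= ltnn andbF.
have nil_in (b : bool) l : ([::] \in [seq (M.+1, b) :: s | s <- l]) = false.
  by apply/negbTE/mapP => -[].
have cons_in (b b' : bool) s l :
    ((M.+1, b) :: s \in [seq (M.+1, b') :: s | s <- l]) = (b == b') && (s \in l).
  have [<-|bb'] := eqVneq b b'; first by rewrite mem_map.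
  by apply/negbTE/mapP => -[? _ [] /eqP]; rewrite (negPf bb').
apply: uniq_perm; first exact: uniq_ops.
  rewrite cat_uniq uniq_ops /=; case: ifP => //= _.
  rewrite cat_uniq !(map_inj_uniq (@cinj _)) !uniq_ops /= andbT.
  apply/andP; split; apply/hasPn => x.
    by rewrite mem_cat => /orP[] /mapP[s _ ->]; apply: hd.
  by move=> /mapP[s _ ->]; apply/mapP => -[].
move=> s; rewrite mem_cat; case: s => [|[k b] s].
  rewrite !mem_ops /= !andbT; case: ifP; rewrite ?orbF // => _.
  by rewrite mem_cat !nil_in !orbF.
have [kM|kM] := eqVneq k M.+1; last first.
  have -> : ((k, b) :: s \in if (M < n)%N then
       [seq (M.+1, true) :: s | s <- ops M (n - M.+1)] ++
       [seq (M.+1, false) :: s | s <- ops M.+1 (n - M.+1)] else [::]) = false.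
    apply/negP; case: ifP => // _; rewrite mem_cat.
    by case/orP => /mapP[? _ [kE]]; rewrite kE eqxx in kM.
  rewrite orbF !mem_ops !is_overpartition_cons /=.
  case ks: (all (geq k) (parts s)); last by rewrite !andbF.
  have E (m : nat) : (k <= m)%N -> all (geq m) (parts s).
    by move=> km; apply: sub_all ks => i /= /leq_trans; apply.
  rewrite [(k <= M.+1)%N]leq_eqVlt (negPf kM) /= ltnS.
  case km: (k <= M)%N; last by rewrite andbF.
  by rewrite !E // ltnW.
rewrite {}kM (negPf (hd _ _ _)) /= mem_ops is_overpartition_cons /= leqnn.
case: ifP => [Mn|]; rewrite /= ?andbF //.
rewrite mem_cat !cons_in; case: b => /=.
  have -> : (s \in ops M (n - M.+1)) = (s \in ops M.+1 (n - M.+1)) &&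
      (M.+1 \notin parts s).
    rewrite !mem_ops -andbA; congr andb.
    elim: (parts s) => //= k' r ->; rewrite inE negb_or [(k' <= M.+1)%N]leq_eqVlt.
    rewrite ltnS; have [->|_] := eqVneq k' M.+1; first by rewrite ltnn /= andbF.
    by case: (_ <= _)%N; case: (all _ _); case: (_ \in _).
  by rewrite orbF mem_ops; case: (all _ _); case: (is_overpartition _ _); rewrite /= ?andbT ?andbF.
by rewrite mem_ops andbAC andbb andbC.
Qed.

Lemma ops_size_le (M n : nat) : (n <= M)%N -> perm_eq (ops M n) (ops n n).
Proof.
move=> nM; apply: uniq_perm; rewrite ?uniq_ops // => s.
rewrite !mem_ops; case os: (is_overpartition n s) => //=.
rewrite (part_le_size os); apply: sub_all (part_le_size os) => k /=.
by move=> /leq_trans; apply.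
Qed.

Lemma card_overpartitions (n : nat) : card_of (overpartitions n) = size (ops n n).
Proof.
rewrite /card_of /ops; congr (size (enum_fset (fset_set _))).
by apply/seteqP; split => [s os|s []//]; split => //; exact: part_le_size os.
Qed.

Lemma card_overpartitions_sub (n : nat) (P : pred (seq (nat * bool))) :
  card_of [set s | overpartitions n s /\ P s] = count P (ops n n).
Proof.
rewrite -size_filter; apply: perm_size; apply: uniq_perm.
- exact: fset_uniq.
- by rewrite filter_uniq // uniq_ops.
move=> s; rewrite in_fset_set; last first.
  by apply: (sub_finite_set _ (finite_overpartitions n)) => ? [].
rewrite mem_filter mem_ops; apply/idP/idP.
  by move/set_mem => -[os ->]; rewrite (part_le_size os) andbT.
by case/and3P => Ps os _; apply/mem_set; split.
Qed.

Section WeightedSums.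
Context {R : realType}.
Implicit Types (w : nat -> R) (s : seq (nat * bool)).

Definition weight w s : R := \prod_(p <- s) w p.1.

Definition wsum w (M n : nat) : R := \sum_(s <- ops M n) weight w s.

(** The weight [w j] of a part [j] includes the power [q ^ j], so that this is a
partial sum, by size, of a generating function. *)
Definition wpsum w (M N : nat) : R := \sum_(n < N) wsum w M n.

Lemma wsum0 w (n : nat) : wsum w 0 n = (n == 0%N)%:R.
Proof.
rewrite /wsum (perm_big _ (ops0 n)) /=; case: eqP => _; last by rewrite big_nil.
by rewrite big_seq1 /weight big_nil.
Qed.

Lemma wsumS w (M n : nat) :
  wsum w M.+1 n = wsum w M n +
    if (M < n)%N then w M.+1 * (wsum w M (n - M.+1) + wsum w M.+1 (n - M.+1))
    else 0.
Proof.
rewrite {1}/wsum (perm_big _ (opsS M n)) /= big_cat /=; congr +%R.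
case: ifP => _; last by rewrite big_nil.
rewrite big_cat /= !big_map mulrDr !mulr_sumr.
by congr +%R; apply: eq_bigr => s _; rewrite /weight big_cons.
Qed.

Lemma wpsum0 w (N : nat) : wpsum w 0 N = (0 < N)%N%:R.
Proof.
rewrite /wpsum; case: N => [|N]; first by rewrite big_ord0.
rewrite big_ord_recl wsum0 big1 ?addr0 // => i _.
by rewrite wsum0.
Qed.

Lemma wpsumS w (M N : nat) :
  wpsum w M.+1 N =
    wpsum w M N + w M.+1 * (wpsum w M (N - M.+1) + wpsum w M.+1 (N - M.+1)).
Proof.
rewrite {1}/wpsum; under eq_bigr do rewrite wsumS.
rewrite big_split /=; congr +%R.
rewrite /wpsum -big_split /= mulr_sumr.
rewrite -(big_mkord xpredT (fun i => if (M < i)%N then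
   w M.+1 * (wsum w M (i - M.+1) + wsum w M.+1 (i - M.+1)) else 0)).
rewrite -(big_mkord xpredT (fun i =>
   w M.+1 * (wsum w M i + wsum w M.+1 i))).
have [NM|NM] := leqP N M.+1.
  rewrite (eqP (_ : (N - M.+1 == 0)%N)) // (big_geq (leqnn 0)) big_nat big1 // => i.
  by move=> /= iN; rewrite ifF //; apply/negbTE; rewrite -leqNgt -ltnS (leq_trans iN).
rewrite (@big_cat_nat _ _ _ M.+1) //= ?(ltnW NM) // big_nat big1 ?add0r; last first.
  by move=> i /= iM; rewrite ltnNge -ltnS iM.
rewrite -{1}(add0n M.+1) big_addn.
by apply: eq_bigr => i _; rewrite addnK ifT // ltn_addl.
Qed.

Section Nonneg.
Context (w : nat -> R) (w_ge0 : forall j, 0 <= w j).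

Lemma weight_ge0 s : 0 <= weight w s.
Proof. exact: prodr_ge0. Qed.

Lemma wsum_ge0 (M n : nat) : 0 <= wsum w M n.
Proof. by apply: sumr_ge0 => s _; exact: weight_ge0. Qed.

Lemma wpsum_nondecreasing (M : nat) : nondecreasing_seq (wpsum w M).
Proof.
apply/nondecreasing_seqP => N.
by rewrite /wpsum big_ord_recr /= lerDl wsum_ge0.
Qed.

Context (w_lt1 : forall j, w j.+1 < 1).

(** The partial sums on the right of [wpsumS] are at most those up to [N], which
gives [(1 - w M.+1) * wpsum w M.+1 N <= (1 + w M.+1) * wpsum w M N]. *)
Lemma wpsum_le (M N : nat) :
  wpsum w M N <= \prod_(1 <= j < M.+1) ((1 + w j) / (1 - w j)).
Proof.
elim: M N => [|M IH] N.
  by rewrite wpsum0 big_geq //; case: (0 < N)%N; rewrite ?ler01.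
rewrite big_nat_recr //= mulrA ler_pdivlMr ?subr_gt0 //.
apply: (@le_trans _ _ (wpsum w M N * (1 + w M.+1))); last first.
  by rewrite ler_wpM2r // addr_ge0.
have le1 : wpsum w M (N - M.+1) <= wpsum w M N.
  by apply: wpsum_nondecreasing; exact: leq_subr.
have le2 : wpsum w M.+1 (N - M.+1) <= wpsum w M.+1 N.
  by apply: wpsum_nondecreasing; exact: leq_subr.
have := wpsumS w M N; have := w_ge0 M.+1.
have := ler_wpM2l (w_ge0 M.+1) (lerD le1 le2).
by nra.
Qed.

(** In the limit the truncations in [wpsumS] disappear, and it determines the
limit for [M.+1] from the one for [M]. *)
Lemma wpsum_cvg (M : nat) :
  wpsum w M @ \oo --> \prod_(1 <= j < M.+1) ((1 + w j) / (1 - w j)).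
Proof.
elim: M => [|M IH].
  rewrite big_geq //; apply: cvg_near_cst.
  by exists 1%N => // N /= N0; rewrite wpsum0 N0.
have cv : cvgn (wpsum w M.+1).
  apply: nondecreasing_is_cvgn; first exact: wpsum_nondecreasing.
  exists (\prod_(1 <= j < M.+2) ((1 + w j) / (1 - w j))) => _ [N _ <-].
  exact: wpsum_le.
have shift u (l : R) : u @ \oo --> l -> u (N - M.+1)%N @[N --> \oo] --> l.
  move=> ul; rewrite -(cvg_shiftn M.+1).
  by under eq_fun do rewrite addnK.
have [l ul] : exists l : R, wpsum w M.+1 @ \oo --> l by apply/cvg_ex.
have ul' : wpsum w M.+1 @ \oo -->
    (\prod_(1 <= j < M.+1) ((1 + w j) / (1 - w j)) + w M.+1 *
     (\prod_(1 <= j < M.+1) ((1 + w j) / (1 - w j)) + l) : R).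
  rewrite (_ : wpsum w M.+1 = fun N => wpsum w M N +
      w M.+1 * (wpsum w M (N - M.+1) + wpsum w M.+1 (N - M.+1))); last first.
    by apply/funext => N; exact: wpsumS.
  by apply: cvgD => //; apply: cvgMr; apply: cvgD; exact: shift.
suff -> : \prod_(1 <= j < M.+2) ((1 + w j) / (1 - w j)) = l by [].
have lE : l = _ := cvg_unique (@Rhausdorff R) ul ul'.
rewrite big_nat_recr //= mulrA; apply/eqP.
have w1 : 1 - w M.+1 != 0 by rewrite subr_eq0 eq_sym lt_eqF.
rewrite -[X in _ == X](mulfK w1) (inj_eq (mulIf _)) ?invr_eq0 //.
by apply/eqP; rewrite mulrBr mulr1 [X in X - _]lE; ring.
Qed.

End Nonneg.
End WeightedSums.

(** * Growth of the number of overpartitions *)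

Lemma size_opsS (M n : nat) :
  size (ops M.+1 n) = (size (ops M n) +
    if M < n then size (ops M (n - M.+1)) + size (ops M.+1 (n - M.+1)) else 0)%N.
Proof.
by rewrite (perm_size (opsS M n)) size_cat; case: ifP; rewrite // size_cat !size_map.
Qed.

(** Adding an unmarked part 1 would be an injection; the recursion [size_opsS]
gives the same inequality without handling lists. *)
Lemma size_ops_mono (M n : nat) : (size (ops M.+1 n) <= size (ops M.+1 n.+1))%N.
Proof.
elim: M n => [|M IHM] n.
  by rewrite [leqRHS]size_opsS /= subSS subn0; lia.
elim/ltn_ind: n => n IHn.
rewrite size_opsS [leqRHS]size_opsS; apply: leq_add; first exact: IHM.
case: ifP => // Mn; rewrite ltnS (ltnW Mn) (subSn Mn).
apply: leq_add; first exact: IHM.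
by apply: IHn; lia.
Qed.

Definition pbar (n : nat) : nat := size (ops n n).

Lemma pbar_mono : {homo pbar : m n / (m <= n)%N}.
Proof.
apply: homo_leq; [exact: leqnn|exact: leq_trans|] => n; rewrite /pbar.
by rewrite -(perm_size (ops_size_le (leqnSn n))) size_ops_mono.
Qed.

Lemma size_ops_le (M n : nat) : (size (ops M n) <= pbar n)%N.
Proof.
apply: uniq_leq_size; first exact: uniq_ops.
by move=> s; rewrite !mem_ops => /andP[os _]; rewrite os part_le_size.
Qed.

Section Asymptotics.
Context {R : realType}.
Implicit Types t : R.

(** The weight under which each overpartition of [n] has weight [expR (- t * n)],
as [wsum_boltzmann] records. *)
Definition boltzmann t (j : nat) : R := expR (- (t * j%:R)).

Lemma weight_expR (f : nat -> R) (s : seq (nat * bool)) :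
  weight (fun j => expR (f j)) s = expR (\sum_(k <- parts s) f k).
Proof.
rewrite /weight /parts big_map.
by elim: s => [|p s IH]; rewrite ?big_nil ?expR0 // !big_cons IH expRD.
Qed.

Lemma sumn_parts (n : nat) (s : seq (nat * bool)) :
  is_overpartition n s -> \sum_(k <- parts s) k%:R = n%:R :> R.
Proof.
by case/and4P => _ _ _ /eqP <-; rewrite sumnE natr_sum.
Qed.

Lemma wsum_boltzmann t (M n : nat) :
  wsum (boltzmann t) M n = (size (ops M n))%:R * expR (- (t * n%:R)).
Proof.
rewrite /wsum (eq_big_seq (fun=> expR (- (t * n%:R)))).
  by rewrite big_const_seq count_predT iter_addr_0 mulr_natl.
move=> s; rewrite mem_ops => /andP[os _].
by rewrite weight_expR sumrN -mulr_sumr (sumn_parts os).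
Qed.

Lemma prod_expR (x : nat -> R) (m n : nat) : (forall j, (m <= j < n)%N -> 0 < x j) ->
  \prod_(m <= j < n) ((1 + expR (- x j)) / (1 - expR (- x j))) =
  expR (\sum_(m <= j < n) Phi (x j)).
Proof.
move=> x0; rewrite expR_sum big_nat [RHS]big_nat.
by apply: eq_bigr => j /x0 xj; rewrite expR_Phi.
Qed.

Lemma boltzmann_ge0 t (j : nat) : 0 <= boltzmann t j.
Proof. exact: expR_ge0. Qed.

Definition pbar_psum t (N : nat) : R := \sum_(m < N) (pbar m)%:R * expR (- (t * m%:R)).

Lemma boltzmann_lt1 t (j : nat) : 0 < t -> boltzmann t j.+1 < 1.
Proof. by move=> t0; apply: expRN_lt1; rewrite mulr_gt0. Qed.

Lemma wpsum_boltzmann_le t (M N : nat) : wpsum (boltzmann t) M N <= pbar_psum t N.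
Proof.
apply: ler_sum => m _; rewrite wsum_boltzmann ler_wpM2r ?expR_ge0 //.
by rewrite ler_nat size_ops_le.
Qed.

Lemma pbar_psum_le t (N : nat) : 0 < t -> pbar_psum t N <= expR (pi ^+ 2 / 4 / t).
Proof.
move=> t0; have -> : pbar_psum t N = wpsum (boltzmann t) N N.
  apply: eq_bigr => m _; rewrite wsum_boltzmann /pbar.
  by rewrite -(perm_size (ops_size_le (ltnW (ltn_ord m)))).
apply: le_trans (wpsum_le (boltzmann_ge0 t) (fun j => boltzmann_lt1 j t0) N N) _.
rewrite (prod_expR (x := fun j => t * j%:R)) ?ler_expR ?sum_Phi_le //.
by move=> j /andP[j0 _]; rewrite mulr_gt0 // ltr0n.
Qed.

Lemma pbar_psum_ge (e : R) : 0 < e -> exists2 t0 : R, 0 < t0 &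
  forall t, 0 < t < t0 -> exists N : nat,
    expR ((pi ^+ 2 / 4 - e) / t) / 2 <= pbar_psum t N.
Proof.
move=> e0; have [t0 t00 H] := sum_Phi_ge e0; exists t0 => // t tt0.
have [M HM] := H _ tt0; have /andP[t_gt0 _] := tt0.
have := wpsum_cvg (M := M) (boltzmann_ge0 t) (fun j => boltzmann_lt1 j t_gt0).
rewrite (prod_expR (x := fun j => t * j%:R)); last first.
  by move=> j /andP[j0 _]; rewrite mulr_gt0 // ltr0n.
set S := \sum_(1 <= j < M.+1) _ in HM *.
move=> /cvgr_ge /(_ (expR ((pi ^+ 2 / 4 - e) / t) / 2)).
have -> : expR ((pi ^+ 2 / 4 - e) / t) / 2 < expR S.
  by have := expR_gt0 S; rewrite -ler_expR in HM; lra.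
move=> /(_ isT) [N _ HN]; exists N.
exact: le_trans (HN N (leqnn N)) (wpsum_boltzmann_le _ _ _).
Qed.

(** The three terms bound the contributions of the sizes below [n1], above [n] and
in between. For the first two, Chernoff's bound tilts the parameter by [s],
upwards for the small sizes and downwards for the large ones. *)
Lemma pbar_psum_split t (s n1 : R) (n N : nat) : 0 < s < t ->
  pbar_psum t N <= expR (s * n1 + pi ^+ 2 / 4 / (t + s)) +
              expR (pi ^+ 2 / 4 / (t - s) - s * n%:R) +
              n.+1%:R * (pbar n)%:R * expR (- (t * n1)).
Proof.
move=> /andP[s0 st].
have ts1 : 0 < t + s by lra.
have ts2 : 0 < t - s by lra.
apply: (@le_trans _ _ (expR (s * n1) * pbar_psum (t + s) N +
    expR (- (s * n%:R)) * pbar_psum (t - s) N +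
    \sum_(m < N) (m <= n)%N%:R * ((pbar n)%:R * expR (- (t * n1))))).
  rewrite /pbar_psum !mulr_sumr -!big_split /=; apply: ler_sum => m _.
  have pm : 0 <= (pbar m)%:R :> R by [].
  have E1 := expR_ge0 (s * n1 - (t + s) * m%:R).
  have E2 := expR_ge0 (- (s * n%:R) - (t - s) * m%:R).
  have E3 := expR_ge0 (- (t * n1)).
  rewrite [X in X + _ + _]mulrCA [X in _ + X + _]mulrCA -!expRD.
  have n3 : 0 <= (m <= n)%N%:R * ((pbar n)%:R * expR (- (t * n1))).
    by rewrite !mulr_ge0.
  have [mn1|mn1] := leP m%:R n1.
    rewrite -addrA; apply: ler_wpDr; first by rewrite addr_ge0 // mulr_ge0.
    rewrite ler_wpM2l // ler_expR.
    have := ler_wpM2l (ltW s0) mn1; lra.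
  have [nm|mn] := ltnP n m.
    rewrite mul0r addr0; apply: ler_wpDl; first by rewrite mulr_ge0.
    rewrite ler_wpM2l // ler_expR.
    have : n%:R <= m%:R :> R by rewrite ler_nat ltnW.
    move/(ler_wpM2l (ltW s0)); lra.
  rewrite mul1r; apply: ler_wpDl; first by rewrite addr_ge0 // mulr_ge0.
  rewrite ler_pM ?expR_ge0 // ?ler_nat ?pbar_mono // ler_expR lerN2 ler_pM2l ?ltW //.
  exact: lt_trans s0 st.
rewrite !expRD -mulr_suml -[n.+1%:R * _ * _]mulrA; apply: lerD; first apply: lerD.
- by rewrite ler_wpM2l ?expR_ge0 // pbar_psum_le.
- by rewrite mulrC ler_wpM2r ?expR_ge0 // pbar_psum_le.
rewrite ler_wpM2r ?mulr_ge0 ?expR_ge0 // -natr_sum ler_nat.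
elim: N => [|N IH]; first by rewrite big_ord0.
rewrite big_ord_recr /=; have [Nn|Nn] := leqP N n; last by rewrite addn0.
rewrite addn1 ltnS; apply: leq_trans Nn.
apply: leq_trans (_ : \sum_(i < N) 1 <= _)%N; last by rewrite sum1_card card_ord.
by apply: leq_sum => i _; exact: leq_b1.
Qed.

Lemma near_sqrt_ge (A : R) : \forall n \near \oo, A <= Num.sqrt (n%:R : R).
Proof.
exists (Num.bound (A ^+ 2)) => // n /= An.
have [A0|A0] := leP A 0; first by rewrite (le_trans A0).
rewrite -[A]gtr0_norm // -sqrtr_sqr ler_sqrt //.
rewrite (le_trans (ltW (archi_boundP (sqr_ge0 A)))) // ler_nat //.
Qed.

(** Both left-hand sides are at most [1 - sg * th + 2 * sg ^ 2], by expanding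
[(1 + sg)^-1], [(1 - sg)^-1] and [(1 - th)^-1]; this is minimal at
[sg = th / 4]. *)
Lemma tilt_bounds (r : R) (th : R := 1 - r ^+ 2) (sg : R := th / 4) : 1 / 2 <= r < 1 ->
  sg * r ^+ 2 + (1 + sg)^-1 <= 1 - th ^+ 2 / 8 /\
  (1 - sg)^-1 - sg / r ^+ 2 <= 1 - th ^+ 2 / 8.
Proof.
move=> /andP[r1 r2].
have th0 : 0 < th by rewrite /th; nra.
have th1 : th < 1 by rewrite /th; nra.
have -> : r ^+ 2 = 1 - th by rewrite /th; ring.
rewrite /sg; move: th th0 th1 {sg} => th th0 th1; split.
  have : (1 + th / 4)^-1 <= 1 - th / 4 + (th / 4) ^+ 2.
    by rewrite -[leLHS]mul1r ler_pdivrMr; [nra|lra].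
  by nra.
have h1 : (1 - th / 4)^-1 <= 1 + th / 4 + 2 * (th / 4) ^+ 2.
  by rewrite -[leLHS]mul1r ler_pdivrMr; [nra|lra].
have h2 : 1 + th <= (1 - th)^-1.
  by rewrite -[leRHS]mul1r ler_pdivlMr; [nra|lra].
have : th / 4 * (1 + th) <= th / 4 * (1 - th)^-1 by rewrite ler_wpM2l //; lra.
by nra.
Qed.

(** At the parameter [t] with [pi ^ 2 / 4 / t = u = (pi / 2) * sqrt n * r] the
logarithm of the generating function is close to [u], and its mass concentrates
on sizes near [u / t = n * r ^ 2]. The sizes below [n * r ^ 4] or above [n] are
negligible, and each of the at most [n + 1] others contributes at most
[pbar n * expR (- (u * r ^ 2))], since [pbar] is nondecreasing. *)
Lemma pbar_ge_tilted (r : R) (k : R := (1 - r ^+ 2) ^+ 2 / 8) : 1 / 2 <= r < 1 ->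
  \forall n \near \oo,
    expR (pi / 2 * Num.sqrt n%:R * r * (r ^+ 2 + (1 - k / 2))) <=
    4 * n.+1%:R * (pbar n)%:R.
Proof.
move=> r12; have /andP[r1 r2] := r12.
pose th : R := 1 - r ^+ 2; pose sg : R := th / 4.
have th0 : 0 < th < 1 by rewrite /th; nra.
have sg0 : 0 < sg < 1 by rewrite /sg; lra.
have k0 : 0 < k by rewrite divr_gt0 // exprn_gt0 //; case/andP: th0.
have p2 : 2 <= (pi : R) by exact: pi_ge2.
have p4 : (pi : R) < 4 by have := @pihalf_lt2 R; lra.
pose C : R := pi ^+ 2 / 4.
have C0 : 0 < C by rewrite divr_gt0 // exprn_gt0; lra.
have [t0 t00 Ht0] := @pbar_psum_ge (C * (k / 2)) (mulr_gt0 C0 (divr_gt0 k0 (ltr0n _ 2))).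
have [b1 b2] := tilt_bounds r12.
near=> n.
(* The first bound serves [uk], the second serves [tt0]. *)
have c1 : 28 / k <= Num.sqrt (n%:R : R) by near: n; exact: near_sqrt_ge.
have c2 : 10 / t0 <= Num.sqrt (n%:R : R) by near: n; exact: near_sqrt_ge.
set c : R := Num.sqrt (n%:R : R) in c1 c2 *.
have cn : c ^+ 2 = n%:R by rewrite sqr_sqrtr.
have c0 : 0 < c by apply: lt_le_trans c1; rewrite divr_gt0.
set u : R := pi / 2 * c * r.
have u0 : c / 2 <= u.
  have pr : 1 / 2 <= pi / 2 * r by clear -p2 r1; nra.
  have -> : u = c * (pi / 2 * r) by rewrite /u; ring.
  by rewrite ler_pM2l //; clear -pr; lra.
have u_gt0 : 0 < u by apply: lt_le_trans u0; rewrite divr_gt0.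
pose t : R := C / u.
have t_gt0 : 0 < t by rewrite divr_gt0.
have CE : C = t * u by rewrite divfK ?lt0r_neq0.
have tE : C / t = u by rewrite CE mulrC mulKf ?lt0r_neq0.
have r_gt0 : 0 < r by apply: lt_le_trans r1.
have tn : t * n%:R = u / r ^+ 2.
  have p0 : (pi : R) != 0 by rewrite lt0r_neq0 // pi_gt0.
  rewrite -cn /t /C /u; move: (pi : R) p0 => p p0.
  by field; rewrite p0 !lt0r_neq0.
have tr : t * (n%:R * r ^+ 4) = u * r ^+ 2.
  by rewrite mulrA tn; field; exact: lt0r_neq0.
have tt0 : t < t0.
  rewrite ler_pdivrMr // in c2.
  rewrite ltr_pdivrMr // /C; have : c / 2 * t0 <= u * t0 by rewrite ler_wpM2r // ltW.
  by clear -c2 p2 p4; nra.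
have [N HN] := Ht0 _ (introT andP (conj t_gt0 tt0)).
have HL : expR (u * (1 - k / 2)) / 2 <= pbar_psum t N.
  by move: HN; rewrite -/C (_ : (C - C * (k / 2)) / t = u * (1 - k / 2)) // -tE; ring.
have /andP[sg_gt0 sg_lt1] := sg0.
have stt : 0 < sg * t < t by rewrite mulr_gt0 // gtr_pMl.
have := @pbar_psum_split t (sg * t) (n%:R * r ^+ 4) n N stt.
set E1 := expR (_ + _); set E2 := expR (_ - _); rewrite tr => HZ.
have H1 : E1 <= expR (u * (1 - k)).
  rewrite ler_expR -mulrA tr -/C.
  have -> : C / (t + sg * t) = u / (1 + sg).
    rewrite (_ : t + sg * t = t * (1 + sg)); last by ring.
    by rewrite CE -mulf_div mulfV ?mul1r ?lt0r_neq0.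
  have -> : sg * (u * r ^+ 2) + u / (1 + sg) = u * (sg * r ^+ 2 + (1 + sg)^-1).
    by ring.
  by rewrite ler_pM2l.
have H2 : E2 <= expR (u * (1 - k)).
  rewrite ler_expR -[sg * t * _]mulrA tn -/C.
  have -> : C / (t - sg * t) = u / (1 - sg).
    rewrite (_ : t - sg * t = t * (1 - sg)); last by ring.
    by rewrite CE -mulf_div mulfV ?mul1r ?lt0r_neq0.
  have -> : u / (1 - sg) - sg * (u / r ^+ 2) = u * ((1 - sg)^-1 - sg / r ^+ 2).
    by ring.
  by rewrite ler_pM2l.
(* [H1] and [H2] save [u * k] in the exponent while [HL] loses only [u * (k / 2)];
   the difference absorbs the constants. *)
have uk : 8 <= expR (u * (k / 2)).
  apply: le_trans (expR_ge1Dx _).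
  by rewrite ler_pdivrMr // in c1; clear -c1 u0 k0; nra.
have uE : expR (u * (1 - k / 2)) = expR (u * (1 - k)) * expR (u * (k / 2)).
  by rewrite -expRD; congr expR; field.
have big : expR (u * (1 - k / 2)) <= 4 * n.+1%:R * (pbar n)%:R * expR (- (u * r ^+ 2)).
  have := ler_wpM2l (expR_ge0 (u * (1 - k))) uk; rewrite -uE.
  by clear -HL HZ H1 H2; lra.
by rewrite mulrDr expRD mulrC -ler_pdivlMr ?expR_gt0 // -expRN.
Unshelve. all: by end_near.
Qed.

(** Let [r] tend to 1 in [pbar_ge_tilted]; half of [e] pays for the distance of
[r] to 1, the other half for the polynomial factor. *)
Lemma pbar_ge (e : R) : 0 < e ->
  \forall n \near \oo, expR ((pi - e) * Num.sqrt n%:R) <= (pbar n)%:R.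
Proof.
move=> e0.
(* The exponent loses at most [pi / 2 * 5 * d], which is at most [e / 2]. *)
pose d : R := Num.min (1 / 2) (e / 20).
have d0 : 0 < d by rewrite lt_min !divr_gt0.
have d1 : d <= 1 / 2 by rewrite ge_min lexx.
have de : 20 * d <= e by rewrite mulrC -ler_pdivlMr // ge_min lexx orbT.
have r0 : 1 / 2 <= 1 - d < 1 by clear -d0 d1; lra.
have main := pbar_ge_tilted r0.
near=> n.
have c1 : 1 <= Num.sqrt (n%:R : R) by near: n; exact: near_sqrt_ge.
(* The cubic term of [expR (c * (e / 2))] beats the factor [4 * (c ^ 2 + 1)]. *)
have c2 : 8 * 48 / e ^+ 3 <= Num.sqrt (n%:R : R) by near: n; exact: near_sqrt_ge.
have : expR (pi / 2 * Num.sqrt n%:R * (1 - d) *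
    ((1 - d) ^+ 2 + (1 - (1 - (1 - d) ^+ 2) ^+ 2 / 8 / 2))) <=
    4 * n.+1%:R * (pbar n)%:R by near: n; exact: main.
set c : R := Num.sqrt (n%:R : R) in c1 c2 *.
have c0 : 0 < c by apply: lt_le_trans c1.
have n1E : n.+1%:R = c ^+ 2 + 1 :> R by rewrite sqr_sqrtr // natr1.
rewrite n1E => big.
have c21 : 0 < 4 * (c ^+ 2 + 1) by rewrite mulr_gt0 // addr_gt0 // exprn_gt0.
have ce : 4 * (c ^+ 2 + 1) <= expR (c * (e / 2)).
  have e2 : 0 <= c * (e / 2) by rewrite ltW // mulr_gt0 // divr_gt0.
  apply: le_trans (expR_ge1Dxn 2 e2).
  rewrite ler_pdivrMr ?exprn_gt0 // in c2.
  have -> : (c * (e / 2)) ^+ 3 / 3`!%:R = c ^+ 2 * (c * e ^+ 3) / 48.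
    by rewrite (_ : 3`! = 6)%N //; field.
  have : c ^+ 2 * (8 * 48) <= c ^+ 2 * (c * e ^+ 3) by rewrite ler_wpM2l ?exprn_ge0 // ltW.
  by move: c1; clear; nra.
rewrite -(ler_pM2l c21) (le_trans _ big) //.
apply: (@le_trans _ _ (expR (c * (e / 2)) * expR ((pi - e) * c))).
  by rewrite ler_wpM2r // expR_ge0.
rewrite -expRD ler_expR.
have -> : c * (e / 2) + (pi - e) * c = c * (pi - e / 2) by field.
set x := ((1 - d) ^+ 2 + _).
have -> : pi / 2 * c * (1 - d) * x = c * (pi / 2 * ((1 - d) * x)) by ring.
rewrite ler_pM2l //.
have x_ge : 2 - 2 * d - d / 8 <= x.
  have y : 0 <= 1 - (1 - d) ^+ 2 <= 2 * d by move: d0 d1; clear; nra.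
  have : (1 - (1 - d) ^+ 2) ^+ 2 <= 2 * d by move: y d1; clear; nra.
  by rewrite /x; move: d0 d1; clear; nra.
have rx : 2 - 5 * d <= (1 - d) * x by move: x_ge d0 d1; clear; nra.
have p0 : 0 <= (pi : R) / 2 by rewrite divr_ge0 // pi_ge0.
have := ler_wpM2l p0 rx; have := @pihalf_lt2 R.
by move: d0 de; clear; nra.
Unshelve. all: by end_near.
Qed.

End Asymptotics.

(** * Deviations of the number of large parts *)

Definition nparts_ge (k : nat) (s : seq (nat * bool)) : nat := count (leq k) (parts s).

Section Chernoff.
Context {R : realType}.
Implicit Types (t d K : R) (f : nat -> R).

(** Chernoff's bound: on [P] the weight [expR (B - \sum f)] is at least 1, and
the total weight is bounded by the Euler product. *)
Lemma count_le_expR f (B : R) (n : nat) (P : pred (seq (nat * bool))) :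
  (forall j, 0 < f j.+1) ->
  (forall s, is_overpartition n s -> P s -> \sum_(k <- parts s) f k <= B) ->
  (count P (ops n n))%:R <= expR (B + \sum_(1 <= j < n.+1) Phi (f j)).
Proof.
move=> f0 PB; pose w j := expR (- f j).
have w0 j : 0 <= w j by exact: expR_ge0.
have w1 j : w j.+1 < 1 by exact: expRN_lt1.
rewrite expRD -(prod_expR (x := f)); last by case.
apply: (@le_trans _ _ (expR B * wsum w n n)); last first.
  rewrite ler_wpM2l ?expR_ge0 //; apply: le_trans (wpsum_le w0 w1 n n.+1).
  by rewrite /wpsum big_ord_recr /= lerDr sumr_ge0 // => i _; exact: wsum_ge0.
rewrite /wsum mulr_sumr -sum1_count natr_sum big_mkcond /=.
rewrite big_seq [leRHS]big_seq; apply: ler_sum => s; rewrite mem_ops => /andP[os _].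
rewrite weight_expR -expRD sumrN; case: ifP => Ps; last exact: expR_ge0.
by rewrite (le_trans _ (expR_ge1Dx _)) // lerDl subr_ge0 PB.
Qed.

Lemma sum_parts_shift t (u : R) (k n : nat) (s : seq (nat * bool)) :
  is_overpartition n s ->
  \sum_(j <- parts s) (t * j%:R + (if (k <= j)%N then u else 0)) =
  t * n%:R + u * (nparts_ge k s)%:R.
Proof.
move=> os; rewrite big_split /= -mulr_sumr (sumn_parts os); congr +%R.
rewrite -big_mkcond /= /nparts_ge -sum1_count natr_sum mulr_sumr.
by apply: eq_bigr => j _; rewrite mulr1.
Qed.

Lemma sum_nat_shift (F : nat -> R) (a m n : nat) :
  \sum_(m + a <= j < n + a) F j = \sum_(m <= j < n) F (j + a)%N.
Proof. by rewrite big_addn addnK. Qed.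

(** Tilting [nparts_ge k] by a multiple [t * a] of the mesh replaces [Phi (t * j)]
by [Phi (t * (j - a))] for [j >= k]: compared with the untilted sum, only the
[a] terms with [k - a <= j < k] are repeated. *)
Lemma sum_Phi_shift_down t (a k n : nat) : 0 < t -> (a < k)%N ->
  \sum_(1 <= j < n.+1) Phi (t * j%:R + (if (k <= j)%N then - (t * a%:R) else 0)) <=
  pi ^+ 2 / 4 / t + a%:R * Phi (t * (k - a)%:R).
Proof.
move=> t0 ak; have k1 : (1 <= k)%N := leq_ltn_trans (leq0n _) ak.
pose F (j : nat) : R := Phi (t * j%:R + (if (k <= j)%N then - (t * a%:R) else 0)).
rewrite -[leLHS]/(\sum_(1 <= j < n.+1) F j).
have F0 j : (1 <= j)%N -> 0 <= F j.
  move=> j1; rewrite ltW // Phi_gt0 //; case: ifP => kj; last first.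
    by rewrite addr0 mulr_gt0 // ltr0n.
  rewrite -mulrBr mulr_gt0 // subr_gt0 ltr_nat; exact: leq_trans ak kj.
have nk : (n.+1 <= k + n)%N by rewrite -addn1 addnC leq_add2r.
apply: (@le_trans _ _ (\sum_(1 <= j < k + n + a) F j)).
  rewrite [leRHS](@big_cat_nat _ _ _ n.+1) //=; last by apply: leq_trans nk (leq_addr _ _).
  rewrite lerDl big_nat sumr_ge0 // => j /andP[j1 _].
  by apply: F0; apply: leq_trans j1.
rewrite (@big_cat_nat _ _ _ k) //=; last by rewrite -addnA leq_addr.
have -> : \sum_(1 <= j < k) F j = \sum_(1 <= j < k) Phi (t * j%:R).
  by rewrite big_nat [RHS]big_nat; apply: eq_bigr => j /andP[_ jk];
    rewrite /F leqNgt jk addr0.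
have -> : \sum_(k <= j < k + n + a) F j = \sum_(k - a <= j < k + n) Phi (t * j%:R).
  rewrite -{1}(subnK (ltnW ak)) sum_nat_shift.
  rewrite big_nat [RHS]big_nat; apply: eq_bigr => j /andP[kj _].
  by rewrite /F ifT; [congr Phi; rewrite natrD; ring | lia].
rewrite [X in _ + X](@big_cat_nat _ _ _ k) ?leq_subr ?leq_addr //= addrCA.
rewrite -(@big_cat_nat _ _ _ k) ?leq_addr //= addrC; apply: lerD.
  have -> : (k + n = (k + n).-1.+1)%N by lia.
  exact: sum_Phi_le.
apply: (@le_trans _ _ (\sum_(k - a <= j < k) Phi (t * (k - a)%:R))).
  rewrite big_nat [leRHS]big_nat; apply: ler_sum => j /andP[j1 _].
  by rewrite Phi_le ?ler_pM2l ?ler_nat // mulr_gt0 // ltr0n subn_gt0.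
rewrite sumr_const_nat subKn; last exact: ltnW.
by rewrite -[X in X <= _]mulr_natl lexx.
Qed.

(** For a tilt in the other direction, the [a] terms with [k <= j < k + a] are
lost. *)
Lemma sum_Phi_shift_up t (a k n : nat) : 0 < t -> (0 < k)%N ->
  \sum_(1 <= j < n.+1) Phi (t * j%:R + (if (k <= j)%N then t * a%:R else 0)) <=
  pi ^+ 2 / 4 / t - a%:R * Phi (t * (k + a)%:R).
Proof.
move=> t0 k1.
pose F (j : nat) : R := Phi (t * j%:R + (if (k <= j)%N then t * a%:R else 0)).
rewrite -[leLHS]/(\sum_(1 <= j < n.+1) F j).
have F0 j : (1 <= j)%N -> 0 <= F j.
  move=> j1; rewrite ltW // Phi_gt0 //; apply: ltr_wpDr.
    by case: ifP => // _; rewrite mulr_ge0 // ltW.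
  by rewrite mulr_gt0 // ltr0n.
have nk : (n.+1 <= k + n)%N by rewrite -addn1 addnC leq_add2r.
apply: (@le_trans _ _ (\sum_(1 <= j < k + n) F j)).
  rewrite [leRHS](@big_cat_nat _ _ _ n.+1) //=.
  rewrite lerDl big_nat sumr_ge0 // => j /andP[j1 _].
  by apply: F0; apply: leq_trans j1.
rewrite (@big_cat_nat _ _ _ k) //= ?leq_addr //.
have -> : \sum_(1 <= j < k) F j = \sum_(1 <= j < k) Phi (t * j%:R).
  by rewrite big_nat [RHS]big_nat; apply: eq_bigr => j /andP[_ jk];
    rewrite /F leqNgt jk addr0.
have -> : \sum_(k <= j < k + n) F j = \sum_(k + a <= j < k + n + a) Phi (t * j%:R).
  rewrite sum_nat_shift.
  rewrite big_nat [RHS]big_nat; apply: eq_bigr => j /andP[kj _].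
  by rewrite /F kj natrD mulrDr.
rewrite lerBrDr.
apply: (@le_trans _ _ (\sum_(1 <= j < (k + n + a).-1.+1) Phi (t * j%:R))); last exact: sum_Phi_le.
have -> : ((k + n + a).-1.+1 = k + n + a)%N by lia.
rewrite [leRHS](@big_cat_nat _ _ _ k) //=; last by rewrite -addnA leq_addr.
rewrite -addrA lerD2l [leRHS](@big_cat_nat _ _ _ (k + a)%N) ?leq_addr //=; last first.
  by rewrite leq_add2r leq_addr.
rewrite addrC lerD2r.
apply: (@le_trans _ _ (\sum_(k <= j < k + a) Phi (t * (k + a)%:R))).
  by rewrite sumr_const_nat addKn -[X in _ <= X]mulr_natl lexx.
rewrite [leLHS]big_nat [leRHS]big_nat; apply: ler_sum => j /andP[j1 j2].
rewrite Phi_le ?ler_pM2l ?ler_nat ?(ltnW j2) // mulr_gt0 // ltr0n.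
exact: leq_trans k1 j1.
Qed.

Lemma count_nparts_ge t d K (a k n : nat) : 0 < t -> (a < k)%N ->
  Phi (t * (k - a)%:R) + d <= t * K ->
  (count (fun s => K <= (nparts_ge k s)%:R) (ops n n))%:R <=
  expR (t * n%:R + pi ^+ 2 / 4 / t - a%:R * d).
Proof.
move=> t0 ak HK.
pose f j : R := t * j%:R + (if (k <= j)%N then - (t * a%:R) else 0).
have f0 j : 0 < f j.+1.
  rewrite /f; case: ifP => kj; last by rewrite addr0 mulr_gt0 // ltr0n.
  rewrite -mulrBr mulr_gt0 // subr_gt0 ltr_nat; exact: leq_trans ak kj.
apply: le_trans (@count_le_expR f (t * n%:R - t * a%:R * K) n _ f0 _) _.
  move=> s os KN; rewrite (sum_parts_shift _ _ _ os) lerD2l mulNr lerN2.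
  by rewrite ler_wpM2l // mulr_ge0 // ltW.
rewrite ler_expR.
have := sum_Phi_shift_down n t0 ak; rewrite -/f => H.
have := ler_wpM2l (ler0n R a) HK.
by move: H; set S := \sum_(1 <= j < n.+1) _; clear; nra.
Qed.

Lemma count_nparts_le t d K (a k n : nat) : 0 < t -> (0 < k)%N ->
  t * K <= Phi (t * (k + a)%:R) - d ->
  (count (fun s => (nparts_ge k s)%:R <= K) (ops n n))%:R <=
  expR (t * n%:R + pi ^+ 2 / 4 / t - a%:R * d).
Proof.
move=> t0 k0 HK.
pose f j : R := t * j%:R + (if (k <= j)%N then t * a%:R else 0).
have f0 j : 0 < f j.+1.
  rewrite /f; apply: ltr_wpDr; last by rewrite mulr_gt0.
  by case: ifP => // _; rewrite mulr_ge0 // ltW.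
apply: le_trans (@count_le_expR f (t * n%:R + t * a%:R * K) n _ f0 _) _.
  move=> s os KN; rewrite (sum_parts_shift _ _ _ os) lerD2l.
  by rewrite ler_wpM2l // mulr_ge0 // ltW.
rewrite ler_expR.
have := sum_Phi_shift_up a n t0 k0; rewrite -/f => H.
have := ler_wpM2l (ler0n R a) HK.
by move: H; set S := \sum_(1 <= j < n.+1) _; clear; nra.
Qed.

Definition limit_shape (z : R) : R := 2 / pi * Phi (pi / 2 * z).

(** The real height [z * c] lies between [k] and [k.+1]. An upper bound on the
number of parts at [k] and a lower bound at [k.+1] are what monotonicity can
transfer to the neighbouring heights. *)
Definition deviates (d z : R) (n : nat) (s : seq (nat * bool)) : bool :=
  let c := Num.sqrt n%:R in
  let k := Num.truncn (z * c) in
  (c * (limit_shape z + d) <= (nparts_ge k s)%:R) ||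
  ((nparts_ge k.+1 s)%:R <= c * (limit_shape z - d)).

(** At [t = pi / (2 * sqrt n)] the trivial exponent [t * n + pi ^ 2 / 4 / t] is
[pi * sqrt n], the growth rate of [pbar]. A shift [a] of order [sqrt n] makes
the gain [a * d] linear in [sqrt n], while it moves the argument of [Phi] by at
most [eta], which costs at most half of the allowed deviation. *)
Lemma count_deviates (d z : R) : 0 < d -> 0 < z ->
  exists2 kappa : R, 0 < kappa &
    \forall n \near \oo, (count (deviates d z n) (ops n n))%:R <=
      2 * expR ((pi - kappa) * Num.sqrt n%:R).
Proof.
move=> d0 z0.
have p0 := pi_gt0 R.
have x0 : 0 < pi / 2 * z by rewrite mulr_gt0 // divr_gt0.
have e0 : 0 < pi / 4 * d by rewrite mulr_gt0 // divr_gt0.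
have [eta eta0 Heta] := Phi_cont x0 e0.
pose al : R := Num.min (z / 4) (eta / 4).
have al0 : 0 < al by rewrite lt_min !divr_gt0.
have alz : al <= z / 4 by rewrite ge_min lexx.
have ale : al <= eta / 4 by rewrite ge_min lexx orbT.
have p1 := @pihalf_ge1 R; have p2 := @pihalf_lt2 R.
exists (al * d / 4); first by rewrite divr_gt0 // mulr_gt0.
near=> n.
have : 2 / al <= Num.sqrt (n%:R : R) by near: n; exact: near_sqrt_ge.
rewrite /deviates; set c : R := Num.sqrt (n%:R : R) => c1.
have c0 : 0 < c by apply: lt_le_trans c1; rewrite divr_gt0.
have cn : c ^+ 2 = n%:R by rewrite sqr_sqrtr.
rewrite ler_pdivrMr // in c1.
have /andP[k1 k2] := @truncn_itv R (z * c) (ltW (mulr_gt0 z0 c0)).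
have /andP[a1 a2] := @truncn_itv R (al * c) (ltW (mulr_gt0 al0 c0)).
set k := Num.truncn (z * c) in k1 k2 *; set a := Num.truncn (al * c) in a1 a2.
rewrite -natr1 in k2; rewrite -natr1 in a2.
pose t : R := pi / 2 / c.
have t0 : 0 < t by rewrite !divr_gt0.
have tc : t * c = pi / 2 by rewrite divfK ?lt0r_neq0.
have tz : t * (z * c) = pi / 2 * z by rewrite mulrCA tc mulrC.
have ta : t * (2 * (al * c)) <= eta.
  rewrite (_ : _ * _ = t * c * (2 * al)); last by ring.
  by rewrite tc; move: ale p2 al0 eta0 p1; clear; nra.
have ak : (a < k)%N.
  rewrite -(ltr_nat R); move: k2 a1 c1 alz c0; clear; nra.
have expo : t * n%:R + pi ^+ 2 / 4 / t - a%:R * (pi / 4 * d) <=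
    (pi - al * d / 4) * c.
  have -> : t * n%:R + pi ^+ 2 / 4 / t = pi * c.
    rewrite -cn /t; move: (pi : R) p0 => p p0; field.
    by rewrite !lt0r_neq0.
  rewrite mulrBl lerD2l lerN2.
  have : al * c / 2 * (1 / 2 * d) <= a%:R * (pi / 4 * d).
    apply: ler_pM; rewrite ?mulr_ge0 ?(ltW d0) ?(ltW al0) ?(ltW c0) //.
      by move: a2 c1; clear; lra.
    by rewrite ler_pM2r //; move: p1; clear; lra.
  by move: (pi : R) => p; clear; lra.
have ls : t * (c * limit_shape z) = Phi (pi / 2 * z).
  rewrite mulrA tc /limit_shape mulrA; move: (pi : R) (Phi _) p0 => p P p0.
  by field; rewrite lt0r_neq0.
apply: (@le_trans _ _ (
   (count (fun s => c * (limit_shape z + d) <= (nparts_ge k s)%:R) (ops n n))%:R +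
   (count (fun s => (nparts_ge k.+1 s)%:R <= c * (limit_shape z - d)) (ops n n))%:R)).
  rewrite -natrD ler_nat -count_predUI.
  exact: leq_addr.
rewrite mulr_natl mulr2n; apply: lerD.
  apply: le_trans (_ : _ <= expR _) _; last by rewrite ler_expR; exact: expo.
  apply: count_nparts_ge => //.
  have y0 : 0 < t * (k - a)%:R by rewrite mulr_gt0 // ltr0n subn_gt0.
  have [H _] := Heta _ y0.
  apply: (@le_trans _ _ (Phi (pi / 2 * z) + pi / 4 * d + pi / 4 * d)).
    rewrite lerD2r; apply: H; rewrite natrB ?(ltnW ak) // -tz.
    have : t * (z * c - 2 * (al * c)) <= t * (k%:R - a%:R).
      by rewrite ler_pM2l //; move: k2 a1 c1; clear; lra.
    by move: ta; clear; lra.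
  rewrite !mulrDr ls; rewrite [t * (c * d)]mulrA tc; move: (pi : R) => p; clear; lra.
apply: le_trans (_ : _ <= expR _) _; last by rewrite ler_expR; exact: expo.
apply: count_nparts_le => //.
have y0 : 0 < t * (k.+1 + a)%:R by rewrite mulr_gt0 // ltr0n.
have [_ H] := Heta _ y0.
apply: (@le_trans _ _ (Phi (pi / 2 * z) - pi / 4 * d - pi / 4 * d)); last first.
  rewrite lerD2r; apply: H; rewrite natrD -natr1 -tz.
  have : t * (k%:R + 1 + a%:R) <= t * (z * c + 2 * (al * c)).
    by rewrite ler_pM2l //; move: k1 a1 c1; clear; lra.
  by move: ta; clear; lra.
rewrite !mulrBr ls; rewrite [t * (c * d)]mulrA tc; move: (pi : R) => p; clear; lra.
Unshelve. all: by end_near.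
Qed.

(** [pbar_ge] loses only half of the exponential gain of [count_deviates]. *)
Lemma count_deviates_small (d z h : R) : 0 < d -> 0 < z -> 0 < h ->
  \forall n \near \oo, (count (deviates d z n) (ops n n))%:R <= h * (pbar n)%:R.
Proof.
move=> d0 z0 h0; have [ka ka0 Hka] := count_deviates d0 z0.
have Hp := @pbar_ge R (ka / 2) (divr_gt0 ka0 (ltr0n _ 2)).
near=> n.
have H1 : (count (deviates d z n) (ops n n))%:R <=
      2 * expR ((pi - ka) * Num.sqrt n%:R) by near: n; exact: Hka.
have H2 : expR ((pi - ka / 2) * Num.sqrt n%:R) <= (pbar n)%:R by near: n; exact: Hp.
have : 2 / h / (ka / 2) <= Num.sqrt (n%:R : R) by near: n; exact: near_sqrt_ge.
set c : R := Num.sqrt (n%:R : R) in H1 H2 * => c1.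
rewrite ler_pdivrMr ?divr_gt0 // in c1.
apply: le_trans H1 _.
apply: le_trans (ler_wpM2l (ltW h0) H2).
have -> : (pi - ka / 2) * c = (pi - ka) * c + c * (ka / 2) by field.
rewrite expRD [h * _]mulrCA [2 * _]mulrC ler_wpM2l ?expR_ge0 //.
rewrite -ler_pdivrMl // mulrC; apply: le_trans c1 _.
by apply: le_trans (expR_ge1Dx _); rewrite lerDr.
Unshelve. all: by end_near.
Qed.

End Chernoff.

(** * The limit curve and its inverse *)

Section LimitCurve.
Context {R : realType}.
Implicit Types x y z : R.

Lemma pfun_invP (f : pfun R) (E : set R) (g : R -> R) :
  (forall x, pdom f x -> E (pval f x) /\ g (pval f x) = x) ->
  (forall y, E y -> pdom f (g y) /\ pval f (g y) = y) ->
  [/\ pinj f, pdom (pfun_inv f) = E &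
      forall y, E y -> pval (pfun_inv f) y = g y].
Proof.
move=> fE gD.
have inj : pinj f.
  move=> x x' /set_mem /fE[_ gx] /set_mem /fE[_ gx'] e.
  by rewrite -gx -gx' e.
split => //.
  apply/seteqP; split => [_ [x /fE[Ex _] <-]//|y /gD[Dy <-]].
  by exists (g y) => //; case: (gD y).
move=> y /gD[Dy e]; rewrite -[in LHS]e /=.
by apply: pinvKV; [exact: inj|exact/mem_set].
Qed.

Lemma pihalf_gt0 : 0 < (pi : R) / 2.
Proof. by rewrite divr_gt0 // pi_gt0. Qed.

Lemma twopi_ln (a : R) : - (pi / 2) * (- (2 / pi) * ln a) = ln a.
Proof.
have := pi_gt0 R; move: (pi : R) => p p0.
by rewrite mulrA (_ : - (p / 2) * - (2 / p) = 1) ?mul1r //; field; rewrite lt0r_neq0.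
Qed.

Lemma twopi_expR x : - (2 / pi) * ln (expR (- (pi / 2) * x)) = x.
Proof.
rewrite expRK; have := pi_gt0 R; move: (pi : R) => p p0.
by rewrite mulrA (_ : - (2 / p) * - (p / 2) = 1) ?mul1r //; field; rewrite lt0r_neq0.
Qed.

Lemma expR_pihalf_lt1 x : 0 < x -> expR (- (pi / 2) * x) < 1.
Proof. by move=> x0; rewrite mulNr expRN_lt1 // mulr_gt0 // pihalf_gt0. Qed.

Lemma ntwopi_ln_gt0 (a : R) : 0 < a < 1 -> 0 < - (2 / pi) * ln a.
Proof.
by move=> a01; rewrite nmulr_lgt0 ?oppr_lt0 ?divr_gt0 ?pi_gt0 // ln_lt0.
Qed.

(** [h1] is an involution. *)
Lemma h1_invP :
  [/\ pinj (h1 R), pdom (pfun_inv (h1 R)) = [set x | 0 < x] &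
      forall y, 0 < y -> pval (pfun_inv (h1 R)) y = pval (h1 R) y].
Proof.
have H x : 0 < x -> 0 < pval (h1 R) x /\ pval (h1 R) (pval (h1 R) x) = x.
  move=> x0; have e0 := expR_gt0 (- (pi / 2) * x); have e1 := expR_pihalf_lt1 x0.
  rewrite /=; split; first by apply: ntwopi_ln_gt0; lra.
  rewrite twopi_ln lnK ?posrE ?subr_gt0 // (_ : 1 - (1 - _) = expR (- (pi / 2) * x)).
    exact: twopi_expR.
  by ring.
exact: pfun_invP.
Qed.

Definition h2_inv y : R := - (2 / pi) * ln (1 + expR (- (pi / 2) * y)).

Lemma h2_invP :
  [/\ pinj (h2 R), pdom (pfun_inv (h2 R)) = [set x | 0 <= x] &
      forall y, 0 <= y -> pval (pfun_inv (h2 R)) y = h2_inv y].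
Proof.
have p0 := pihalf_gt0.
have q0 : - (2 / (pi : R)) < 0 by rewrite oppr_lt0 divr_gt0 // pi_gt0.
apply: pfun_invP => [x /= /andP[x1 x2]|y /= y0].
  have e1 : 1 < expR (- (pi / 2) * x) by rewrite expR_gt1 mulNr -mulrN mulr_gt0 // oppr_gt0.
  have e2 : expR (- (pi / 2) * x) <= 2.
    rewrite -[leRHS]lnK ?posrE // ler_expR -[leRHS]twopi_ln.
    by rewrite ler_nM2l // oppr_lt0.
  split.
    by rewrite nmulr_rge0 // ln_le0 // lerBlDr.
  rewrite /h2_inv twopi_ln lnK ?posrE ?subr_gt0 // addrC subrK.
  exact: twopi_expR.
have e0 := expR_gt0 (- (pi / 2) * y).
have e1 : expR (- (pi / 2) * y) <= 1.
  by rewrite expR_le1 mulNr oppr_le0 mulr_ge0 // ltW.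
have e2 : 0 < 1 + expR (- (pi / 2) * y) by rewrite addr_gt0.
split.
  rewrite /h2_inv ler_nM2l // nmulr_rlt0 // ln_gt0 ?ltrDl // andbT.
  by rewrite ler_ln ?posrE //; lra.
by rewrite /h2_inv twopi_ln lnK ?posrE // addrAC subrr add0r twopi_expR.
Qed.

Lemma limit_shapeE x : limit_shape x =
  2 / pi * ln ((1 + expR (- (pi / 2) * x)) / (1 - expR (- (pi / 2) * x))).
Proof. by rewrite /limit_shape /Phi mulNr. Qed.

Lemma limit_shape_gt0 x : 0 < x -> 0 < limit_shape x.
Proof.
move=> x0; rewrite mulr_gt0 ?divr_gt0 ?pi_gt0 // Phi_gt0 // mulr_gt0 //.
exact: pihalf_gt0.
Qed.

Lemma limit_shapeK x : 0 < x -> limit_shape (limit_shape x) = x.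
Proof.
move=> x0; rewrite /limit_shape; have := pi_gt0 R => p0.
have -> : pi / 2 * (2 / pi * Phi (pi / 2 * x)) = Phi (pi / 2 * x).
  move: (pi : R) (Phi _) p0 => p P p0; by field; rewrite lt0r_neq0.
rewrite PhiK; last by rewrite mulr_gt0 // pihalf_gt0.
by move: (pi : R) p0 => p p0; field; rewrite lt0r_neq0.
Qed.

Lemma limit_shape_decr x y : 0 < x -> x < y -> limit_shape y < limit_shape x.
Proof.
move=> x0 xy; rewrite ltr_pM2l ?divr_gt0 ?pi_gt0 // Phi_decr ?ltr_pM2l ?pihalf_gt0 //.
by rewrite mulr_gt0 // pihalf_gt0.
Qed.

(** [limit_shape] is its own inverse because [Phi] is, so that the last inversion
in the definition of [f_overp] returns the same function. *)
Lemma f_overpP :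
  [/\ pinj (pfun_sub (pfun_inv (h1 R)) (pfun_inv (h2 R))),
      pdom (f_overp R) = [set x | 0 < x] &
      forall x, 0 < x -> pval (f_overp R) x = limit_shape x].
Proof.
have [_ D1 V1] := h1_invP; have [_ D2 V2] := h2_invP.
have val x : 0 < x ->
    pval (pfun_sub (pfun_inv (h1 R)) (pfun_inv (h2 R))) x = limit_shape x.
  move=> x0; rewrite [LHS]/= -[X in X - _]/(pval (pfun_inv (h1 R)) x).
  rewrite -[X in _ - X]/(pval (pfun_inv (h2 R)) x).
  rewrite V1 // V2 ?ltW // limit_shapeE /h2_inv /=.
  have a1 : 0 < 1 + expR (- (pi / 2) * x) by rewrite addr_gt0 ?expR_gt0.
  have a2 : 0 < 1 - expR (- (pi / 2) * x) by rewrite subr_gt0 expR_pihalf_lt1.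
  by rewrite ln_div ?posrE //; ring.
have dom : pdom (pfun_sub (pfun_inv (h1 R)) (pfun_inv (h2 R))) = [set x | 0 < x].
  rewrite [LHS]/= -[X in X `&` _]/(pdom (pfun_inv (h1 R))).
  rewrite -[X in _ `&` X]/(pdom (pfun_inv (h2 R))) D1 D2.
  by apply/seteqP; split => x /= => [[]|x0] //; split => //; exact: ltW.
apply: pfun_invP => [x|y y0]; rewrite dom.
  by move=> x0; rewrite val //; split; [exact: limit_shape_gt0|exact: limit_shapeK].
have y0' := limit_shape_gt0 y0.
by split => //; rewrite val // limit_shapeK.
Qed.

End LimitCurve.

(** * From finitely many heights to the whole shape *)

Lemma nth_ge_count (l : seq nat) (i k : nat) :
  sorted geq l -> (i < size l)%N -> (k <= nth 0 l i)%N -> (i < count (leq k) l)%N.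
Proof.
elim: l i => // x l IH [|i] /=; first by move=> _ _ ->.
rewrite (path_sortedE (rev_trans leq_trans)) => /andP[xl sl] il kl.
have -> : (k <= x)%N by apply: leq_trans kl (allP xl _ (mem_nth _ _)).
by rewrite add1n ltnS; exact: IH.
Qed.

Lemma nth_lt_count (l : seq nat) (i k : nat) :
  sorted geq l -> (nth 0 l i < k)%N -> (count (leq k) l <= i)%N.
Proof.
elim: l i => // x l IH [|i] /=.
  rewrite (path_sortedE (rev_trans leq_trans)) => /andP[xl _] xk.
  rewrite [(k <= x)%N]leqNgt xk add0n leqNgt -has_count; apply/hasPn => y /(allP xl) /= yx.
  by rewrite -ltnNge (leq_ltn_trans yx).
rewrite (path_sortedE (rev_trans leq_trans)) => /andP[_ sl] /(IH _ sl) cl.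
by rewrite -add1n leq_add // leq_b1.
Qed.

Section Geometry.
Context {R : realType}.

(** A point of the boundary has to its left exactly the columns that are higher,
up to those that end at its own height. *)
Lemma shape_nparts (s : seq (nat * bool)) (p : R * R) :
  sorted geq (parts s) -> Defs.shape R s p ->
  [/\ 0 <= p.1, 0 <= p.2,
      forall k : nat, k%:R <= p.2 -> p.1 <= (nparts_ge k s)%:R &
      forall k : nat, p.2 < k%:R -> (nparts_ge k s)%:R <= p.1].
Proof.
case: p => x y /= ss [i]; rewrite -(size_map fst) => il.
case=> /= [[/andP[x1 x2] ->]|[-> /andP[y1 y2]]].
  split => // [|k|k]; first exact: le_trans x1.
    by rewrite ler_nat => /(nth_ge_count ss il) ik; rewrite (le_trans x2) // ler_nat.
  by rewrite ltr_nat => /(nth_lt_count ss) ik; rewrite (le_trans _ x1) // ler_nat.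
split => // [|k|k]; first exact: le_trans y1.
  by move=> /le_trans /(_ y2); rewrite ler_nat => /(nth_ge_count ss il); rewrite ler_nat.
by move=> /(le_lt_trans y1); rewrite ltr_nat => /(nth_lt_count ss); rewrite ler_nat.
Qed.

(** The grid is equally spaced horizontally: the curve meets abscissa
[i * (eps / 2)] at height [limit_shape (i * (eps / 2))]. Near the two axes
nothing has to be controlled, so finitely many heights suffice. *)
Lemma renorm_shape_sub (eps : R) (n : nat) (s : seq (nat * bool)) :
  0 < eps -> (0 < n)%N -> is_overpartition n s ->
  (forall i : nat, (i < (Num.truncn (limit_shape eps / (eps / 2))).+1)%N ->
     ~~ deviates (eps / 2) (limit_shape (i.+1%:R * (eps / 2))) n s) ->
  renorm_shape R s `<=` N_eps eps (f_overp R).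
Proof.
move=> e0 n0 os Hdev; have /and4P[ss _ _ /eqP sn] := os.
have [_ fdom fval] := @f_overpP R.
move=> _ [[x y] /(shape_nparts ss)[/= x0 y0 Hk1 Hk2] <-]; rewrite sn.
set c : R := Num.sqrt n%:R.
have c0 : 0 < c by rewrite sqrtr_gt0 ltr0n.
have e2 : 0 < eps / 2 by rewrite divr_gt0.
have [xe|xe] := leP (x / c) eps; first by right; rewrite /= ger0_norm // divr_ge0 // ltW.
have [ye|ye] := leP (y / c) eps.
  by left; right; rewrite /= ger0_norm // divr_ge0 // ltW.
left; left; set z := y / c in ye *; set v := limit_shape z.
have z0 : 0 < z := lt_trans e0 ye.
have v0 : 0 < v := limit_shape_gt0 z0.
exists v; split; rewrite ?fdom // ?fval ?limit_shapeK //=.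
set i := Num.truncn (v / (eps / 2)).
have /andP[i1 i2] : i%:R <= v / (eps / 2) < i.+1%:R.
  by apply: truncn_itv; rewrite divr_ge0 // ltW.
rewrite ler_pdivlMr // in i1; rewrite ltr_pdivrMr // in i2.
have im : (i < (Num.truncn (limit_shape eps / (eps / 2))).+1)%N.
  rewrite ltnS; apply: le_truncn; rewrite ler_pM2r ?invr_gt0 //.
  by apply/ltW/limit_shape_decr.
have yE : y = z * c by rewrite /z divfK // lt0r_neq0.
have := Hdev _ im; rewrite negb_or -ltNge limit_shapeK ?mulr_gt0 // -/c => /andP[up _].
have xup : x < c * (i.+1%:R * (eps / 2) + eps / 2).
  apply: le_lt_trans up; apply: Hk1.
  set z' := limit_shape _.
  have z'z : z' < z by rewrite -[z]limit_shapeK // limit_shape_decr.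
  have /andP[+ _] : (Num.truncn (z' * c))%:R <= z' * c < _ :=
    truncn_itv (ltW (mulr_gt0 (limit_shape_gt0 (mulr_gt0 (ltr0Sn _ _) e2)) c0)).
  by move=> /le_trans; apply; rewrite yE ler_pM2r // ltW.
have xlo : v - eps <= x / c.
  case: (posnP i) => [i0|i_gt0].
    rewrite i0 mul1r in i2; apply: le_trans (_ : 0 <= _); first by move: e0 i2; clear; lra.
    by rewrite divr_ge0 // ltW.
  have im' : (i.-1 < (Num.truncn (limit_shape eps / (eps / 2))).+1)%N.
    by apply: leq_ltn_trans im; exact: leq_pred.
  have iv0 : 0 < i%:R * (eps / 2) by rewrite mulr_gt0 // ltr0n.
  have := Hdev _ im'; rewrite (prednK i_gt0) negb_or -!ltNge limit_shapeK // -/c.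
  move=> /andP[_ lo].
  have xl : c * (i%:R * (eps / 2) - eps / 2) < x.
    apply: lt_le_trans lo _; apply: Hk2.
    set z' := limit_shape _.
    have zz' : z <= z'.
      rewrite -[z]limit_shapeK // /z' le_eqVlt; move: i1; rewrite le_eqVlt.
      move=> /predU1P[->|i1]; first by rewrite eqxx.
      by rewrite limit_shape_decr // orbT.
    have /andP[_] : (Num.truncn (z' * c))%:R <= z' * c < _ :=
      truncn_itv (ltW (mulr_gt0 (limit_shape_gt0 iv0) c0)).
    by apply: le_lt_trans; rewrite yE ler_pM2r.
  rewrite ler_pdivlMr // mulrC; apply: le_trans (ltW xl); rewrite ler_pM2l //.
  by rewrite -natr1 in i2; move: i2; clear; lra.
have xhi : x / c <= v + eps.
  rewrite ler_pdivrMr // mulrC; apply: le_trans (ltW xup) _; rewrite ler_pM2l //.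
  by rewrite -natr1; move: i1; clear; lra.
by rewrite ler_norml; apply/andP; split; move: xlo xhi; clear; lra.
Qed.

End Geometry.

(** A union bound over the finitely many heights of [renorm_shape_sub]. *)
Lemma card_good_shape_ge (R : realType) (eps h : R) : 0 < eps -> 0 < h ->
  \forall n \near \oo, (1 - h) * (card_of (overpartitions n))%:R <=
    (card_of [set s | overpartitions n s /\
       renorm_shape R s `<=` N_eps eps (f_overp R)])%:R.
Proof.
move=> e0 h0.
pose m := (Num.truncn (limit_shape eps / (eps / 2))).+1.
pose z (i : nat) : R := limit_shape (i.+1%:R * (eps / 2)).
have z0 i : 0 < z i by rewrite limit_shape_gt0 // mulr_gt0 // divr_gt0.
have e2 : 0 < eps / 2 by rewrite divr_gt0.
have hm : 0 < h / m%:R by rewrite divr_gt0 // ltr0n.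
have small : \forall n \near \oo, forall i : 'I_m,
    (count (deviates (eps / 2) (z i) n) (ops n n))%:R <= h / m%:R * (pbar n)%:R.
  by apply: filter_forall => i; exact: count_deviates_small.
near=> n.
have n0 : (0 < n)%N by near: n; exists 1%N.
have Hn : forall i : 'I_m,
    (count (deviates (eps / 2) (z i) n) (ops n n))%:R <= h / m%:R * (pbar n)%:R.
  by near: n; exact: small.
pose good s := `[< renorm_shape R s `<=` N_eps eps (f_overp R) >].
have -> : [set s | overpartitions n s /\ renorm_shape R s `<=` N_eps eps (f_overp R)] =
    [set s | overpartitions n s /\ good s].
  by apply/seteqP; split => s /= [os gs]; split => //; apply/asboolP.
rewrite card_overpartitions_sub card_overpartitions -/(pbar n).
have bad : (count (predC good) (ops n n) <=
    \sum_(i < m) count (deviates (eps / 2) (z i) n) (ops n n))%N.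
  have cE (P : pred (seq (nat * bool))) :
      count P (ops n n) = (\sum_(s <- ops n n) P s)%N.
    by rewrite -sum1_count big_mkcond; apply: eq_bigr => s _; case: (P s).
  rewrite cE [leqRHS](eq_bigr _ (fun i _ => cE _)).
  rewrite exchange_big /= big_seq [leqRHS]big_seq; apply: leq_sum => s.
  rewrite mem_ops => /andP[os _]; case: (boolP (good s)) => //= /negP ngood.
  have [i di] : exists i : 'I_m, deviates (eps / 2) (z i) n s.
    apply: contrapT => nd; apply: ngood; apply/asboolP.
    apply: (renorm_shape_sub e0 n0 os) => i im; apply/negP => di.
    by apply: nd; exists (Ordinal im).
  by rewrite (bigD1 i) //= di.
have badR : (count (predC good) (ops n n))%:R <= h * (pbar n)%:R :> R.
  rewrite -(ler_nat R) natr_sum in bad; apply: le_trans bad _.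
  apply: (@le_trans _ _ (\sum_(i < m) (h / m%:R * (pbar n)%:R))).
    by apply: ler_sum => i _; exact: Hn.
  by rewrite sumr_const card_ord -[_ *+ m]mulr_natr mulrAC divfK // pnatr_eq0.
have tot : (pbar n)%:R =
    (count good (ops n n))%:R + (count (predC good) (ops n n))%:R :> R.
  by rewrite -natrD count_predC.
by move: badR tot; clear; lra.
Unshelve. all: by end_near.
Qed.


Unset Implicit Arguments.

Theorem corollary1p5 (R : realType) (eps : R) (heps : 0 < eps) :
  [/\ (* the inverse functions in the definition of f_overp make sense *)
      [/\ pinj (h1 R), pinj (h2 R) &
          pinj (pfun_sub (pfun_inv (h1 R)) (pfun_inv (h2 R)))],
      (* f_overp is a function on the positive reals, with the stated formula *)
      pdom (f_overp R) = [set x | 0 < x],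
      (forall x : R, 0 < x ->
         pval (f_overp R) x =
         2 / pi * ln ((1 + expR (- (pi / 2) * x)) /
                      (1 - expR (- (pi / 2) * x)))) &
      (fun n : nat =>
         (card_of (overpartitions n))%:R^-1 *
         (card_of [set s | overpartitions n s /\
                           renorm_shape R s `<=` N_eps eps (f_overp R)])%:R)
        @ \oo --> (1 : R)].
Proof.
have [i1 _ _] := @h1_invP R; have [i2 _ _] := @h2_invP R.
have [i3 fdom fval] := @f_overpP R.
split => //; first by move=> x x0; rewrite fval // limit_shapeE.
apply/cvgrPdist_le => h h0.
have pos := @pbar_ge R 1 ltr01.
have main := card_good_shape_ge heps h0.
near=> n.
have p0 : 0 < (card_of (overpartitions n))%:R :> R.
  have p1 : expR ((pi - 1) * Num.sqrt n%:R) <= (pbar n)%:R :> R.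
    by near: n; exact: pos.
  by rewrite card_overpartitions; exact: lt_le_trans (expR_gt0 _) p1.
have lo : (1 - h) * (card_of (overpartitions n))%:R <=
    (card_of [set s | overpartitions n s /\
       renorm_shape R s `<=` N_eps eps (f_overp R)])%:R by near: n; exact: main.
have up : (card_of [set s | overpartitions n s /\
       renorm_shape R s `<=` N_eps eps (f_overp R)])%:R <=
    (card_of (overpartitions n))%:R :> R.
  rewrite ler_nat; apply: fsubset_leq_card.
  apply/fsubsetP => s; rewrite !in_fset_set; last 2 first.
  - exact: finite_overpartitions.
  - by apply: (sub_finite_set _ (finite_overpartitions n)) => ? [].
  by rewrite !inE => -[].
rewrite mulrC ger0_norm ?subr_ge0 ?ler_pdivrMr ?mul1r //.
by rewrite lerBlDr -lerBlDl ler_pdivlMr.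
Unshelve. all: by end_near.
Qed.
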